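(* Fix $0<p<\infty$. If $f$ in $\mathscr{H}^p$ is of the form $f(s) = \sum_{n\geq N} a_n n^{-s}$ for some integer $N\geq1$, then $$\|T_\sigma f\|_{\mathscr{H}^p} \leq N^{-\sigma} \|f\|_{\mathscr{H}^p}$$ for every $\sigma\geq0$.
   Context: Hardy spaces of Dirichlet series: for $0<p<\infty$, $\mathscr{H}^p$ is the completion of the set of Dirichlet polynomials $P(s)=\sum_{n\le M} a_n n^{-s}$ in the norm (quasi-norm if $p<1$) given by $\|P\|_{\mathscr{H}^p}^p = \lim_{T\to\infty}\frac{1}{2T}\int_{-T}^T |P(it)|^p\,dt$. Every element of $\mathscr{H}^p$ is identified with a Dirichlet series $f(s)=\sum_{n\ge1}a_n n^{-s}$ which is absolutely convergent for $\operatorname{Re} s>1/2$. For $\sigma\ge0$, $T_\sigma f(s)=f(s+\sigma)$, i.e. $T_\sigma f$ is the Dirichlet series $\sum_{n\ge1}a_n n^{-\sigma}n^{-s}$. *)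

(* Defs.v *)
From HB Require Import structures.
From mathcomp Require Import all_boot all_order all_algebra.
From mathcomp Require Import complex.
From mathcomp Require Import all_classical all_reals all_analysis.

Set Implicit Arguments.
Unset Strict Implicit.
Unset Printing Implicit Defensive.

Import Order.TTheory GRing.Theory Num.Theory.
Import numFieldNormedType.Exports.

Local Open Scope classical_set_scope.
Local Open Scope complex_scope.
Local Open Scope ring_scope.

(** A Dirichlet polynomial [\sum_(1 <= n <= M) a_n n^{-s}] is encoded as
    [P : {poly R[i]}] whose coefficient [P`_n] is [a_n], for [n >= 1].  The
    constant coefficient [P`_0] plays no role: it is ignored by [dpoly_eval],
    hence by [dpoly_norm], and disappears in the quotient defining [Hp]. *)

Section HardySpaces.
Variable R : realType.

(** [n^{-s} = exp (- s ln n)] for a natural number [n >= 1] and complex [s]. *)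
Definition npow_opp (n : nat) (s : R[i]) : R[i] :=
  (expR (- (complex.Re s * ln n%:R)))%:C *
  (cos (complex.Im s * ln n%:R) -i* sin (complex.Im s * ln n%:R)).

Definition dpoly_eval (P : {poly R[i]}) (s : R[i]) : R[i] :=
  \sum_(1 <= n < size P) P`_n * npow_opp n s.

(** The norm of [R[i]] takes values in [R[i]], whence the use of [Re]. *)
Definition dpoly_norm (p : R) (P : {poly R[i]}) : R :=
  (lim ((2 * T)^-1 *
        \int[lebesgue_measure]_(t in `[- T, T])
           (complex.Re `|dpoly_eval P (0 +i* t)| `^ p)
        @[T --> +oo])) `^ p^-1.

Definition dpoly_cauchy (p : R) (u : nat -> {poly R[i]}) : Prop :=
  forall e : R, 0 < e -> exists K : nat, forall j k : nat,
    (K <= j)%N -> (K <= k)%N -> dpoly_norm p (u j - u k) < e.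

Definition dpoly_equiv (p : R) (u v : nat -> {poly R[i]}) : Prop :=
  dpoly_norm p (u k - v k) @[k --> \oo] --> (0 : R).

(** The completion: equivalence classes of Cauchy sequences of Dirichlet
    polynomials. *)
Record Hp (p : R) := MkHp {
  Hp_class : set (nat -> {poly R[i]});
  Hp_classP : exists2 u, dpoly_cauchy p u &
    Hp_class = [set v | dpoly_cauchy p v /\ dpoly_equiv p u v] }.

Definition Hp_repr (p : R) (f : Hp p) : nat -> {poly R[i]} :=
  s2val (cid2 (Hp_classP f)).

Definition Hp_norm (p : R) (f : Hp p) : R :=
  lim (dpoly_norm p (Hp_repr f k) @[k --> \oo]).

(** [f] is identified with the Dirichlet series [\sum_(n >= 1) a n n^{-s}]:
    [a n] is the limit of the [n]-th coefficients of Dirichlet polynomials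
    converging to [f].  The value [a 0] is irrelevant. *)
Definition is_dirichlet_series (p : R) (f : Hp p) (a : nat -> R[i]) : Prop :=
  forall n : nat, (1 <= n)%N ->
    (Hp_repr f k)`_n @[k --> \oo] --> (a n : (R[i] : numFieldType)).

Definition dtranslate (sigma : R) (a : nat -> R[i]) : nat -> R[i] :=
  fun n => (n%:R `^ (- sigma))%:C * a n.

End HardySpaces.

(* Main.v *)
Require Import Defs.
From mathcomp Require Import all_boot all_order all_algebra.
From mathcomp Require Import complex.
From mathcomp Require Import all_classical all_reals all_analysis.
From mathcomp Require Import ring lra.
Set Implicit Arguments.
Unset Strict Implicit.
Unset Printing Implicit Defensive.
Import Order.TTheory GRing.Theory Num.Theory.
Import numFieldNormedType.Exports.
Local Open Scope classical_set_scope.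
Local Open Scope ring_scope.

(** For a general Dirichlet polynomial E(s) = sum c_n exp(- l_n s) with l_n >= 0,
    |E|^p is subharmonic, so the mean over vertical lines
    m(x) = lim_T (2T)^-1 int_[-T,T] |E(x + it)|^p dt has nonnegative second
    derivative in x: the t-part of the Laplacian is averaged away.  A bounded
    convex function on [0, +oo[ is nonincreasing, whence m(x) <= m(0).  If
    P = sum_(n >= N) a_n n^-s, this applied to N^s P(s), whose frequencies
    ln n - ln N are nonnegative, gives ||T_sigma P|| <= N^-sigma ||P||.

    Letting sigma tend to +oo also yields |a_N| <= ||P||, hence the continuity of
    the coefficient functionals.  If w_k is Cauchy and its coefficients tend to 0,
    then removing the terms n < N gives limsup ||T_tau w_k|| <= N^-tau sup ||w_k||
    for every N; so T_tau w_k tends to 0 for each tau > 0, and w_k too because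
    T_tau is contractive and tends strongly to the identity as tau -> 0.  Thus an
    element of the completion is determined by its Dirichlet series, and the
    inequality passes to the limit. *)

(** * Means of almost periodic functions *)

(** Since |E|^p need not be smooth at the zeros of E, no Laplacian is computed. With q = p/2, the
    function |E|^p = (|E|^2)^q is regularized to (|E|^2 + e)^q, and subharmonicity becomes a
    four-point inequality: the values at s + h, s + ih, s - h, s - ih add up to at least four times
    the value at s, minus C h^3 with C uniform on the half-plane Re s >= 0. A defect o(h^2) is
    harmless for convexity, so expansions to second order suffice. The two vertical neighbours have
    the same mean as s itself, which leaves approximate midpoint convexity in x. The regularization
    is removed at the end, uniformly because E is bounded on the half-plane.

    The norm is a [lim], which says something only where the limit exists. All means are therefore
    taken over uniform limits of trigonometric polynomials, an algebra stable under positive powers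
    of its nonnegative elements. For p < 1 the norm is not subadditive, and the estimates in the
    completion use its power of exponent min(p, 1) instead. *)

Section Mean.
Variable R : realType.
Implicit Types (f g : R -> R) (a b c e l T : R).

Definition mean f (T : R) : R :=
  (2 * T)^-1 * \int[lebesgue_measure]_(t in `[- T, T]) f t.

Lemma continuous_integrable_itv f (a b : R) : continuous f ->
  lebesgue_measure.-integrable `[a, b] (EFin \o f).
Proof.
move=> cf; apply: continuous_compact_integrable; first exact: segment_compact.
exact: continuous_subspaceT.
Qed.

Lemma meanD f g T : continuous f -> continuous g ->
  mean (fun t => f t + g t) T = mean f T + mean g T.
Proof.
move=> cf cg; rewrite /mean RintegralD ?mulrDr//; exact: continuous_integrable_itv.
Qed.

Lemma meanZ c f T : continuous f -> mean (fun t => c * f t) T = c * mean f T.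
Proof.
move=> cf; rewrite /mean RintegralZl//; last exact: continuous_integrable_itv.
by rewrite mulrCA.
Qed.

Lemma mean_cst c T : 0 < T -> mean (fun=> c) T = c.
Proof.
move=> T0; rewrite /mean Rintegral_cst //.
rewrite /= lebesgue_measure_itv/= lte_fin.
rewrite ifT; last by lra.
by rewrite -EFinB /=; field; rewrite gt_eqF.
Qed.

Lemma le_mean f g T : 0 < T -> continuous f -> continuous g ->
  (forall t, f t <= g t) -> mean f T <= mean g T.
Proof.
move=> T0 cf cg fg; rewrite /mean ler_wpM2l// ?invr_ge0; first by lra.
by apply: le_Rintegral => //; exact: continuous_integrable_itv.
Qed.

Lemma normr_mean_le f e T : 0 < T -> continuous f ->
  (forall t, `|f t| <= e) -> `|mean f T| <= e.
Proof.
move=> T0 cf fe; rewrite ler_norml; apply/andP; split.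
- rewrite -(mean_cst (- e) T0); apply: le_mean => // [|t]; first exact: cst_continuous.
  by have := fe t; rewrite ler_norml => /andP[].
- rewrite -(mean_cst e T0); apply: le_mean => // [|t]; first exact: cst_continuous.
  by have := fe t; rewrite ler_norml => /andP[].
Qed.

Definition wave (a l b : R) : R -> R := fun t => a * cos (l * t + b).

Lemma is_derive_affine (l b x : R) : is_derive x 1 (fun t : R => l * t + b) l.
Proof.
have -> : (fun t : R => l * t + b) = (l \*: (@id R)) + cst b by [].
by apply: is_derive_eq; rewrite addr0; exact: mulr1.
Qed.

Lemma is_derive_wave_primitive (a l b x : R) : l != 0 ->
  is_derive x 1 (fun t => a / l * sin (l * t + b)) (wave a l b x).
Proof.
move=> l0; have d1 := is_derive_affine l b x.
have d2 : is_derive x 1 (@sin R \o (fun t : R => l * t + b)) (cos (l * x + b) * l).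
  exact: is_derive1_comp.
have -> : (fun t => a / l * sin (l * t + b)) =
  (a / l) \*: (@sin R \o (fun t : R => l * t + b)) by [].
by apply: is_derive_eq; rewrite /wave /GRing.scale/=; field.
Qed.

Lemma continuous_wave a l b : continuous (wave a l b).
Proof.
move=> x; apply: continuousM; first exact: cst_continuous.
apply: (@continuous_comp _ _ _ (fun t => l * t + b) cos); last exact: continuous_cos.
by apply: differentiable_continuous; apply/derivable1_diffP; have [] := is_derive_affine l b x.
Qed.

Lemma mean_wave0 a b T : 0 < T -> mean (wave a 0 b) T = a * cos b.
Proof.
move=> T0; rewrite -[RHS](@mean_cst _ T)//; congr mean; apply/funext => t.
by rewrite /wave mul0r add0r.
Qed.

Lemma normr_mean_wave a l b T : l != 0 -> 0 < T ->
  `|mean (wave a l b) T| <= `|a / l| / T.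
Proof.
move=> l0 T0; pose F t := a / l * sin (l * t + b).
have dF (x : R) : is_derive x 1 F (wave a l b x) by exact: is_derive_wave_primitive.
have cF : continuous F.
  by move=> x; apply: differentiable_continuous; apply/derivable1_diffP; have [] := dF x.
have -> : mean (wave a l b) T = (2 * T)^-1 * (F T - F (- T)).
  rewrite /mean /Rintegral (@continuous_FTC2 _ _ F)//; first by lra.
  - exact/continuous_subspaceT/continuous_wave.
  - split=> [x _||].
    + by have [] := dF x.
    + exact/cvg_at_right_filter/cF.
    + exact/cvg_at_left_filter/cF.
  - by move=> x _; rewrite derive1E derive_val.
have -> : `|a / l| / T = (2 * T)^-1 * (`|a / l| + `|a / l|).
  by field; rewrite gt_eqF.
have c0 : 0 < (2 * T)^-1 by rewrite invr_gt0 mulr_gt0.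
rewrite normrM (gtr0_norm c0) ler_pM2l//.
rewrite (le_trans (ler_normB _ _))// /F !normrM.
by apply: lerD; rewrite ler_piMr// sin_max.
Qed.

(** With a free phase in each wave, real cosines alone give a class that contains the sines and is
    stable under products and translations. *)
Inductive trigpoly : (R -> R) -> Prop :=
| TrigWave a l b : trigpoly (wave a l b)
| TrigAdd f g : trigpoly f -> trigpoly g -> trigpoly (fun t => f t + g t).

Lemma trigpoly_continuous f : trigpoly f -> continuous f.
Proof.
elim=> [a l b|f1 f2 _ c1 _ c2]; first exact: continuous_wave.
by move=> x; apply: continuousD; [exact: c1|exact: c2].
Qed.

Lemma trigpoly_wave_mul a l b f : trigpoly f -> trigpoly (fun t => wave a l b t * f t).
Proof.
elim=> [a' l' b'|f1 f2 _ t1 _ t2]; last first.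
  have -> : (fun t => wave a l b t * (f1 t + f2 t)) =
     (fun t => wave a l b t * f1 t + wave a l b t * f2 t).
    by apply/funext => t; rewrite mulrDr.
  exact: TrigAdd.
have -> : (fun t => wave a l b t * wave a' l' b' t) =
  (fun t => wave (a * a' / 2) (l + l') (b + b') t
          + wave (a * a' / 2) (l - l') (b - b') t).
  apply/funext => t; rewrite /wave.
  rewrite (_ : (l + l') * t + _ = (l * t + b) + (l' * t + b')); last by ring.
  rewrite (_ : (l - l') * t + _ = (l * t + b) - (l' * t + b')); last by ring.
  by move: (l * t + b) (l' * t + b') => u v; rewrite cosD cosB; field.
by apply: TrigAdd; exact: TrigWave.
Qed.

Lemma trigpoly_mul f g : trigpoly f -> trigpoly g -> trigpoly (fun t => f t * g t).
Proof.
move=> tf tg; elim: tf => [a l b|f1 f2 _ t1 _ t2]; first exact: trigpoly_wave_mul.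
have -> : (fun t => (f1 t + f2 t) * g t) = (fun t => f1 t * g t + f2 t * g t).
  by apply/funext => t; rewrite mulrDl.
exact: TrigAdd.
Qed.

Lemma trigpoly_cst c : trigpoly (fun=> c).
Proof.
have -> : (fun=> c) = wave c 0 0.
  by apply/funext => t; rewrite /wave mul0r add0r cos0 mulr1.
exact: TrigWave.
Qed.

Lemma trigpoly_bounded f : trigpoly f -> exists2 B, 0 <= B & forall t, `|f t| <= B.
Proof.
elim=> [a l b|f1 f2 _ [B1 B10 b1] _ [B2 B20 b2]].
  by exists `|a| => // t; rewrite /wave normrM ler_piMr// cos_max.
exists (B1 + B2) => [|t]; first by rewrite addr_ge0.
by rewrite (le_trans (ler_normD _ _))// lerD.
Qed.

Definition wave_mean (a l b : R) := if l == 0 then a * cos b else 0.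

Lemma cvg_mean_wave a l b : mean (wave a l b) T @[T --> +oo] --> wave_mean a l b.
Proof.
rewrite /wave_mean; have [->|l0] := eqVneq l 0.
  apply: cvg_near_cst; near=> T; apply: mean_wave0; near: T; exact: nbhs_pinfty_gt.
apply/cvgr0Pnorm_le => e e0; near=> T.
have T0 : 0 < T by [].
rewrite (le_trans (normr_mean_wave _ _ l0 T0))// ler_pdivrMr// -ler_pdivrMl//.
Unshelve. all: by end_near.
Qed.

(** A translation only adds [l * c] to the phase of a wave: nothing changes at frequency 0, and the
    other waves have mean 0 whatever their phase. Hence one [m] serves for all [c]. *)
Lemma trigpoly_mean f : trigpoly f -> exists m : R, forall c,
  trigpoly (fun t => f (t + c)) /\ mean (fun t => f (t + c)) T @[T --> +oo] --> m.
Proof.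
elim=> [a l b|f1 f2 _ [m1 h1] _ [m2 h2]]; last first.
  exists (m1 + m2) => c; have [t1 c1] := h1 c; have [t2 c2] := h2 c; split.
    exact: TrigAdd t1 t2.
  have -> : mean (fun t => f1 (t + c) + f2 (t + c)) =
    (fun T => mean (fun t => f1 (t + c)) T + mean (fun t => f2 (t + c)) T).
    by apply/funext => T; apply: meanD; exact: trigpoly_continuous.
  exact: cvgD.
exists (wave_mean a l b) => c.
have -> : (fun t => wave a l b (t + c)) = wave a l (l * c + b).
  by apply/funext => t; rewrite /wave mulrDr addrA.
split; first exact: TrigWave.
have -> : wave_mean a l b = wave_mean a l (l * c + b).
  by rewrite /wave_mean; case: eqVneq => // ->; rewrite mul0r add0r.
exact: cvg_mean_wave.
Qed.

(** Uniformly almost periodic functions in the sense of Bohr, introduced as uniform limits of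
    trigonometric polynomials. *)
Definition uap f := forall e : R, 0 < e ->
  exists2 g, trigpoly g & forall t, `|f t - g t| <= e.

Lemma trigpoly_uap f : trigpoly f -> uap f.
Proof. by move=> tf e e0; exists f => // t; rewrite subrr normr0 ltW. Qed.

Lemma uap_cst c : uap (fun=> c).
Proof. exact/trigpoly_uap/trigpoly_cst. Qed.

Lemma uap_bounded f : uap f -> exists2 B, 0 <= B & forall t, `|f t| <= B.
Proof.
move=> /(_ 1 ltr01)[g tg fg]; have [B B0 gB] := trigpoly_bounded tg.
exists (1 + B) => [|t]; first by rewrite addr_ge0.
by rewrite -(subrK (g t) (f t)) (le_trans (ler_normD _ _))// lerD.
Qed.

Lemma uapD f g : uap f -> uap g -> uap (fun t => f t + g t).
Proof.
move=> uf ug e e0; have e20 : 0 < e / 2 by rewrite divr_gt0.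
have [f' tf ff] := uf _ e20; have [g' tg gg] := ug _ e20.
exists (fun t => f' t + g' t); first exact: TrigAdd.
move=> t; rewrite opprD addrACA (le_trans (ler_normD _ _))//.
by rewrite (splitr e) lerD.
Qed.

Lemma uapM f g : uap f -> uap g -> uap (fun t => f t * g t).
Proof.
move=> uf ug e e0.
have [B B0 fB] := uap_bounded uf.
have e10 : 0 < e / (2 * (B + 1)) by rewrite divr_gt0// mulr_gt0//; lra.
have [g' tg gg] := ug _ e10; have [C C0 gC] := trigpoly_bounded tg.
have e20 : 0 < e / (2 * (C + 1)) by rewrite divr_gt0// mulr_gt0//; lra.
have [f' tf ff] := uf _ e20.
exists (fun t => f' t * g' t); first exact: trigpoly_mul.
move=> t.
have -> : f t * g t - f' t * g' t = f t * (g t - g' t) + (f t - f' t) * g' t by ring.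
rewrite (le_trans (ler_normD _ _))// (splitr e) !normrM lerD//.
- rewrite (le_trans (ler_pM _ _ (fB t) (gg t)))//.
  rewrite [leLHS](_ : _ = e / 2 * (B / (B + 1))); last by field; lra.
  have h : B / (B + 1) <= 1 by rewrite ler_pdivrMr; lra.
  by apply: ler_piMr h; lra.
- rewrite (le_trans (ler_pM _ _ (ff t) (gC t)))//.
  rewrite [leLHS](_ : _ = e / 2 * (C / (C + 1))); last by field; lra.
  have h : C / (C + 1) <= 1 by rewrite ler_pdivrMr; lra.
  by apply: ler_piMr h; lra.
Qed.

Lemma uap_lim f : (forall e, 0 < e -> exists2 g, uap g & forall t, `|f t - g t| <= e) ->
  uap f.
Proof.
move=> H e e0; have e20 : 0 < e / 2 by rewrite divr_gt0.
have [g ug fg] := H _ e20; have [h th gh] := ug _ e20.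
exists h => // t; rewrite -(subrKA (g t)) (le_trans (ler_normD _ _))//.
by rewrite (splitr e) lerD.
Qed.

Lemma uap_continuous f : uap f -> continuous f.
Proof.
move=> uf x; apply/cvgrPdist_le => e e0.
have e30 : 0 < e / 3 by rewrite divr_gt0.
have [g tg fg] := uf _ e30.
have /cvgrPdist_le/(_ _ e30) gx := trigpoly_continuous tg (x := x).
near=> y.
have -> : f x - f y = (f x - g x) + (g x - g y) - (f y - g y) by ring.
rewrite (le_trans (ler_normB _ _))// (_ : e = (e / 3 + e / 3) + e / 3); last by field.
rewrite lerD// (le_trans (ler_normD _ _))// lerD//.
by near: y.
Unshelve. all: by end_near.
Qed.

Lemma uap_shift f c : uap f -> uap (fun t => f (t + c)).
Proof.
move=> uf e e0; have [g tg fg] := uf _ e0.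
have [m /(_ c)[tgc _]] := trigpoly_mean tg.
by exists (fun t => g (t + c)).
Qed.

(** Cauchy criterion: averaging does not increase the uniform distance, so the mean of a nearby
    trigonometric polynomial is the centre of a ball that eventually contains [mean f T]. *)
Lemma is_cvg_mean f : uap f -> cvg (mean f T @[T --> +oo]).
Proof.
move=> uf; apply/cauchy_cvgP/cauchyP => e e0.
have e40 : 0 < e / 4 by rewrite divr_gt0.
have [g tg fg] := uf _ e40; have [m /(_ 0)[_ gm]] := trigpoly_mean tg.
have g0 : (fun t => g (t + 0)) = g by apply/funext => t; rewrite addr0.
rewrite g0 in gm.
exists m; suff H : \forall T \near +oo, ball m e (mean f T) by exact: H.
near=> T.
have T0 : 0 < T by near: T; exact: nbhs_pinfty_gt.
rewrite /ball/= -(subrKA (mean g T)) (le_lt_trans (ler_normD _ _))//.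
rewrite (_ : e = e / 2 + e / 2); last by field.
apply: ltr_leD.
  by near: T; move/cvgrPdist_lt : gm; apply; rewrite divr_gt0.
have cf := uap_continuous uf; have cg := trigpoly_continuous tg.
have cNf : continuous (fun t => -1 * f t).
  by move=> x; apply: (@continuousM _ _ (fun=> -1) f); [exact: cst_continuous|exact: cf].
have -> : mean g T - mean f T = mean (fun t => g t + -1 * f t) T.
  by rewrite meanD// meanZ// mulN1r.
apply: normr_mean_le => // [x|t].
  by apply: (@continuousD _ _ _ g (fun t => -1 * f t)); [exact: cg|exact: cNf].
by rewrite mulN1r distrC (le_trans (fg t))//; lra.
Unshelve. all: by end_near.
Qed.

Definition bmean f : R := lim (mean f T @[T --> +oo]).

Lemma bmeanE f : bmean f = lim (mean f T @[T --> +oo]).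
Proof. by []. Qed.

Lemma cvg_mean f : uap f -> mean f T @[T --> +oo] --> bmean f.
Proof. exact: is_cvg_mean. Qed.

Lemma bmeanD f g : uap f -> uap g -> bmean (fun t => f t + g t) = bmean f + bmean g.
Proof.
move=> uf ug; apply: (cvg_unique (@norm_hausdorff _ _) (cvg_mean (uapD uf ug))).
rewrite (_ : mean _ = fun T => mean f T + mean g T); last first.
  by apply/funext => T; apply: meanD; exact: uap_continuous.
by apply: cvgD; exact: cvg_mean.
Qed.

Lemma uapZ c f : uap f -> uap (fun t => c * f t).
Proof. by apply: uapM; exact: uap_cst. Qed.

Lemma bmeanZ c f : uap f -> bmean (fun t => c * f t) = c * bmean f.
Proof.
move=> uf; apply: (cvg_unique (@norm_hausdorff _ _) (cvg_mean (uapZ c uf))).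
rewrite (_ : mean _ = fun T => c * mean f T); last first.
  by apply/funext => T; apply: meanZ; exact: uap_continuous.
by apply: cvgMr; exact: cvg_mean.
Qed.

Lemma bmean_cst c : bmean (fun=> c) = c.
Proof.
apply: cvg_lim => //; apply: cvg_near_cst; near=> T; apply: mean_cst.
by near: T; exact: nbhs_pinfty_gt.
Unshelve. all: by end_near.
Qed.

Lemma le_bmean f g : uap f -> uap g -> (forall t, f t <= g t) -> bmean f <= bmean g.
Proof.
move=> uf ug fg; apply: (ler_lim (is_cvg_mean uf) (is_cvg_mean ug)).
near=> T; apply: le_mean => //; exact: uap_continuous.
Unshelve. all: by end_near.
Qed.

Lemma bmean_ge0 f : uap f -> (forall t, 0 <= f t) -> 0 <= bmean f.
Proof. by move=> uf f0; rewrite -(bmean_cst 0) le_bmean//; exact: uap_cst. Qed.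

Lemma normr_bmeanB_le f g e : uap f -> uap g -> (forall t, `|f t - g t| <= e) ->
  `|bmean f - bmean g| <= e.
Proof.
move=> uf ug fg; rewrite ler_distlC; apply/andP; split.
  rewrite lerBlDr -[leRHS]addrC -(bmean_cst e) -bmeanD//; last exact: uap_cst.
  apply: le_bmean => //; first by apply: uapD => //; exact: uap_cst.
  by move=> t; have := fg t; rewrite ler_distlC => /andP[]; lra.
rewrite -(bmean_cst e) -bmeanD//; last exact: uap_cst.
apply: le_bmean => //; first by apply: uapD => //; exact: uap_cst.
by move=> t; have := fg t; rewrite ler_distlC => /andP[]; lra.
Qed.

(** Inherited from trigonometric polynomials by uniform approximation. This invariance is what
    cancels the vertical neighbours in the four-point inequality. *)
Lemma bmean_shift f c : uap f -> bmean (fun t => f (t + c)) = bmean f.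
Proof.
move=> uf; apply/eqP; rewrite -subr_eq0 -normr_le0; apply/ler_addgt0Pr => e e0.
have e20 : 0 < e / 2 by rewrite divr_gt0.
have [g tg fg] := uf _ e20; have [m gm] := trigpoly_mean tg.
have ugc d : uap (fun t => g (t + d)) by apply/trigpoly_uap; exact: (gm d).1.
have bg d : bmean (fun t => g (t + d)) = m by apply: cvg_lim => //; exact: (gm d).2.
have bg0 : bmean g = m.
  by rewrite -(bg 0); congr bmean; apply/funext => t; rewrite addr0.
rewrite add0r (splitr e) -(subrKA m) (le_trans (ler_normD _ _))// lerD//.
  by rewrite -(bg c) normr_bmeanB_le//; exact: uap_shift.
by rewrite -bg0 distrC normr_bmeanB_le//; exact: trigpoly_uap.
Qed.

End Mean.

#[global] Opaque bmean.

(** * Stability of almost periodicity under positive powers *)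

Section PowerOfUap.
Variable R : realType.
Implicit Types (f : R -> R) (x y a b e q r : R).

(* The expectation of [g (k + S)] for [S] binomial of parameters [n] and [x]. *)
Fixpoint bernstein (g : nat -> R) x (n k : nat) : R :=
  if n is n'.+1 then x * bernstein g x n' k.+1 + (1 - x) * bernstein g x n' k
  else g k.

Lemma le_bernstein (g1 g2 : nat -> R) x n k : 0 <= x <= 1 ->
  (forall j, (j <= n + k)%N -> g1 j <= g2 j) ->
  bernstein g1 x n k <= bernstein g2 x n k.
Proof.
move=> /andP[x0 x1]; elim: n k => [|n IH] k g12 /=; first exact: g12.
apply: lerD; apply: ler_wpM2l => //; rewrite ?subr_ge0//; apply: IH => j jn; apply: g12.
  by rewrite addSnnS.
by rewrite addSn leqW.
Qed.

(** Mean [n x] and variance [n x (1 - x)] of the binomial law; the starting point [k] is general for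
    the sake of the induction. *)
Lemma bernstein_quadratic a b c d x n k :
  bernstein (fun j => a + b * (j%:R * c - d) ^+ 2) x n k =
  a + b * (((k%:R + n%:R * x) * c - d) ^+ 2 + n%:R * (c ^+ 2 * x * (1 - x))).
Proof.
elim: n k => [|n IH] k /=; first by rewrite !mul0r !addr0.
by rewrite !IH -(natr1 n) -(natr1 k); ring.
Qed.

Lemma uap_bernstein (g : nat -> R) f n k : uap f ->
  uap (fun t => bernstein g (f t) n k).
Proof.
move=> uf; elim: n k => [|n IH] k /=; first exact: uap_cst.
apply: uapD; first by apply: uapM.
apply: uapM => //; apply: uapD; first exact: uap_cst.
rewrite (_ : (fun t => _) = (fun t => -1 * f t)); last by apply/funext => t; rewrite mulN1r.
exact: uapZ.
Qed.

(** Bernstein's proof of the Weierstrass theorem. The hypothesis is uniform continuity in the form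
    that Chebyshev's inequality uses: the variance controls the quadratic term. The approximant is a
    polynomial in [f], hence stays in the algebra. *)
Lemma uap_comp_unit (phi : R -> R) f :
  (forall e, 0 < e -> exists2 K, 0 <= K & forall x y, 0 <= x <= 1 -> 0 <= y <= 1 ->
     `|phi y - phi x| <= e + K * (y - x) ^+ 2) ->
  uap f -> (forall t, 0 <= f t <= 1) -> uap (fun t => phi (f t)).
Proof.
move=> H uf f01; apply: uap_lim => e e0; have e20 : 0 < e / 2 by rewrite divr_gt0.
have [K K0 HK] := H _ e20.
(* Large enough for the variance term [K x (1 - x) / (n + 1)] to be at most [e / 2]. *)
have [n Kn] : exists n : nat, 2 * K / e < n.+1%:R.
  by exists (Num.trunc (2 * K / e)); rewrite truncnS_gt.
pose g (j : nat) := phi (j%:R / n.+1%:R).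
exists (fun t => bernstein g (f t) n.+1 0); first exact: uap_bernstein.
have n0 : n.+1%:R != 0 :> R by rewrite pnatr_eq0.
move=> t; have /andP[x0 x1] := f01 t; set x := f t in x0 x1 *.
(* [s] is a sign; its two values give the two halves of the absolute value. *)
have main s : s * s = 1 -> `|s| = 1 ->
    s * (bernstein g x n.+1 0 - phi x) <= e.
  move=> ss s1.
  have -> : s * (bernstein g x n.+1 0 - phi x) = bernstein (fun j => s * (g j - phi x)) x n.+1 0.
    clear; elim: n.+1 0%N => [|m IH] k //=.
    by rewrite -!IH; ring.
  have le1 : bernstein (fun j => s * (g j - phi x)) x n.+1 0 <=
      bernstein (fun j => e / 2 + K * (j%:R * n.+1%:R^-1 - x) ^+ 2) x n.+1 0.
    apply: le_bernstein; first by rewrite x0.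
    move=> j; rewrite addn0 => jn; rewrite (le_trans (ler_norm _))// normrM s1 mul1r.
    apply: HK; first by rewrite x0.
    by rewrite divr_ge0//= ler_pdivrMr ?ltr0n// mul1r ler_nat.
  rewrite (le_trans le1)// bernstein_quadratic.
  rewrite [leLHS](_ : _ = e / 2 + K * (x * (1 - x)) / n.+1%:R); last by field.
  rewrite [leRHS](splitr e) lerD2l.
  rewrite ler_pdivrMr ?ltr0n// (@le_trans _ _ K)//.
    rewrite ler_piMr//; nra.
  by move: Kn; rewrite ltr_pdivrMr//; lra.
rewrite ler_norml; apply/andP; split.
  by have := main 1; rewrite !mul1r normr1 => /(_ erefl erefl); lra.
by have := main (-1); rewrite mulrNN mul1r normrN1 mulN1r => /(_ erefl erefl); lra.
Qed.

(** A ratio [c / (a + b)] in ]0, 1] is at most its own power of exponent [r <= 1]; the two ratios,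
    for [c = a] and [c = b], add up to 1. *)
Lemma powR_subadd a b r : 0 <= a -> 0 <= b -> 0 < r <= 1 ->
  (a + b) `^ r <= a `^ r + b `^ r.
Proof.
move=> a0 b0 /andP[r0 r1].
have [->|an0] := eqVneq a 0; first by rewrite add0r lerDr powR_ge0.
have {a0 an0}a0 : 0 < a by rewrite lt_def an0.
have [->|bn0] := eqVneq b 0; first by rewrite addr0 lerDl powR_ge0.
have {b0 bn0}b0 : 0 < b by rewrite lt_def bn0.
have s0 : 0 < a + b by rewrite addr_gt0.
have P c : 0 < c <= a + b -> c / (a + b) * (a + b) `^ r <= c `^ r.
  move=> /andP[c0 cs].
  have -> : c `^ r = (c / (a + b)) `^ r * (a + b) `^ r.
    by rewrite -powRM ?divfK ?gt_eqF// ?ltW// divr_gt0.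
  by rewrite ler_wpM2r ?powR_ge0// ger1_powR// divr_gt0//= ler_pdivrMr// mul1r.
have Pa : a / (a + b) * (a + b) `^ r <= a `^ r by apply: P; lra.
have Pb : b / (a + b) * (a + b) `^ r <= b `^ r by apply: P; lra.
apply: le_trans (lerD Pa Pb); rewrite -mulrDl -mulrDl divff ?gt_eqF// mul1r//.
Qed.

Lemma powR_dist x y r : 0 <= x -> 0 <= y -> 0 < r <= 1 ->
  `|y `^ r - x `^ r| <= `|y - x| `^ r.
Proof.
move=> x0 y0 r01.
wlog xy : x y x0 y0 / x <= y => [W|].
  have /orP[|] := le_total x y; first exact: W.
  by move=> yx; rewrite distrC (distrC y); exact: W.
have r0 : 0 <= r by lra.
rewrite !ger0_norm ?subr_ge0 ?ge0_ler_powR// lerBlDr.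
by rewrite -{1}(subrK x y) powR_subadd// subr_ge0.
Qed.

Lemma uap_powR_unit f r : 0 < r <= 1 -> uap f -> (forall t, 0 <= f t <= 1) ->
  uap (fun t => f t `^ r).
Proof.
move=> r01; have r0 : 0 < r by lra.
apply: (uap_comp_unit (phi := fun x => x `^ r)) => e e0.
(* At distance at most [d] the Hoelder estimate gives [d ^ r = e]; beyond it the quadratic term
   [(y - x)^2 / d^2] exceeds 1, which bounds the oscillation on [0, 1]. *)
pose d := e `^ r^-1; have d0 : 0 < d by rewrite powR_gt0.
exists (d ^- 2) => [|x y /andP[x0 x1] /andP[y0 y1]]; first by rewrite invr_ge0 exprn_ge0// ltW.
rewrite (le_trans (powR_dist _ _ _))//.
have [yd|yd] := leP `|y - x| d.
  rewrite (@le_trans _ _ e)//; last by rewrite lerDl mulr_ge0 ?sqr_ge0// invr_ge0 exprn_ge0 ?ltW.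
  rewrite (@le_trans _ _ (d `^ r))//.
    by apply: ge0_ler_powR; rewrite ?nnegrE//; apply: ltW.
  by rewrite -powRrM mulVf ?gt_eqF// powRr1// ltW.
rewrite (@le_trans _ _ 1)//.
  rewrite [leRHS](_ : 1 = 1 `^ r); last by rewrite powR1.
  apply: ge0_ler_powR; rewrite ?nnegrE//; first exact: ltW.
  by rewrite ler_norml; lra.
rewrite -[leLHS]add0r; apply: lerD; first exact: ltW.
rewrite [leRHS]mulrC ler_pdivlMr ?exprn_gt0// mul1r.
by rewrite -(real_normK (num_real (y - x))) lerXn2r ?nnegrE// ltW.
Qed.

(** Reduces any positive exponent to one in ]0, 1], where the power is Hoelder continuous, followed
    by an integer power. *)
Lemma powR_root q : 0 < q -> exists n : nat, 0 < q / n.+1%:R <= 1 /\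
  forall x, 0 <= x -> x `^ q = (x `^ (q / n.+1%:R)) ^+ n.+1.
Proof.
move=> q0; exists (Num.trunc q); split.
  rewrite divr_gt0//= ler_pdivrMr// mul1r ltW// truncnS_gt//.
by move=> x x0; rewrite -powR_mulrn ?powR_ge0// -powRrM divfK// pnatr_eq0.
Qed.

Lemma uapX f n : uap f -> uap (fun t => f t ^+ n).
Proof.
move=> uf; elim: n => [|n IH]; first exact: uap_cst.
rewrite (_ : (fun t => _) = (fun t => f t * f t ^+ n)); last first.
  by apply/funext => t; rewrite exprS.
exact: uapM.
Qed.

Lemma uap_powR f q : 0 < q -> uap f -> (forall t, 0 <= f t) -> uap (fun t => f t `^ q).
Proof.
move=> q0 uf f0; have [n [r01 rq]] := powR_root q0; set r := q / _ in r01 rq.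
have [B B0 fB] := uap_bounded uf; have B1 : 0 < B + 1 by lra.
rewrite (_ : (fun t => _) =
    (fun t => ((B + 1) `^ r * ((B + 1)^-1 * f t) `^ r) ^+ n.+1)); last first.
  apply/funext => t; rewrite rq// -powRM ?mulr_ge0 ?invr_ge0 ?(ltW B1)//.
  by rewrite mulrA divff ?gt_eqF// mul1r.
apply: (@uapX (fun t => (B + 1) `^ r * ((B + 1)^-1 * f t) `^ r)); apply: uapZ.
apply: (@uap_powR_unit (fun t => (B + 1)^-1 * f t)) => //; first exact: uapZ.
move=> t; rewrite mulr_ge0 ?invr_ge0 ?(ltW B1)//= mulrC ler_pdivrMr// mul1r.
by rewrite (le_trans (ler_norm _))// (le_trans (fB t)); lra.
Qed.

Lemma subr_exp_le (B u v : R) n : 1 <= B -> 0 <= v <= u -> u <= B ->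
  u ^+ n - v ^+ n <= n%:R * B ^+ n * (u - v).
Proof.
move=> B1 /andP[v0 vu] uB; elim: n => [|n IH]; first by rewrite subrr !mul0r.
have -> : u ^+ n.+1 - v ^+ n.+1 = u * (u ^+ n - v ^+ n) + v ^+ n * (u - v).
  by rewrite !exprS; ring.
have -> : n.+1%:R * B ^+ n.+1 * (u - v) =
    B * (n%:R * B ^+ n * (u - v)) + B ^+ n.+1 * (u - v).
  by rewrite -(natr1 n) !exprS; ring.
have B0 : 0 <= B by lra.
apply: lerD.
  rewrite (@le_trans _ _ (u * (n%:R * B ^+ n * (u - v))))//; first by rewrite ler_wpM2l//; lra.
  by rewrite ler_wpM2r// !mulr_ge0 ?exprn_ge0// subr_ge0.
rewrite ler_wpM2r ?subr_ge0//.
rewrite (@le_trans _ _ (B ^+ n))//; first by rewrite lerXn2r ?nnegrE//; lra.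
by rewrite exprS ler_peMl// exprn_ge0.
Qed.

(** Since [d] does not depend on [y], a regularization by [d] can be removed under the mean. *)
Lemma powR_addr_le q S e : 0 < q -> 0 < e ->
  exists2 d, 0 < d & forall y, 0 <= y <= S -> (y + d) `^ q <= y `^ q + e.
Proof.
move=> q0 e0; have [n [r01 rq]] := powR_root q0; set r := q / _ in r01 rq.
have r0 : 0 < r by lra.
pose B := 1 + (`|S| + 1) `^ r.
have B1 : 1 <= B by rewrite lerDl powR_ge0.
have B0 : 0 < B by lra.
pose c := n.+1%:R * B ^+ n.+1; have c0 : 0 < c by rewrite mulr_gt0// exprn_gt0.
(* The bound 1 keeps [(y + d) ^ r] below [B], where [c] is a Lipschitz constant of the integer
   power; the other bound gives [d ^ r <= e / c]. *)
pose d := Num.min 1 ((e / c) `^ r^-1).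
have d0 : 0 < d by rewrite lt_min ltr01/= powR_gt0// divr_gt0.
exists d => // y /andP[y0 yS].
have yd0 : 0 <= y + d by rewrite addr_ge0// ltW.
have r01' : 0 <= r by lra.
rewrite !rq// -lerBlDl.
rewrite (le_trans (subr_exp_le n.+1 B1 _ _))//.
- by rewrite powR_ge0/= ge0_ler_powR ?nnegrE// lerDl ltW.
- rewrite -[leLHS]add0r; apply: lerD => //.
  apply: ge0_ler_powR; rewrite ?nnegrE ?addr_ge0 ?(ltW d0)//.
  apply: lerD; first by rewrite (le_trans yS)// ler_norm.
  by rewrite /d ge_min lexx.
rewrite -/c mulrC -ler_pdivlMr// lerBlDl (le_trans (powR_subadd _ (ltW d0) r01))//.
rewrite lerD2l (@le_trans _ _ (((e / c) `^ r^-1) `^ r))//.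
  apply: ge0_ler_powR; rewrite ?nnegrE ?powR_ge0 ?(ltW d0)//.
  by rewrite /d ge_min lexx orbT.
by rewrite -powRrM mulVf ?gt_eqF// powRr1// ltW// divr_gt0.
Qed.

End PowerOfUap.

(** * The discrete sub-mean value inequality *)

Section FourPoints.
Variable R : realType.
Implicit Types (h e q K D : R) (z w : R[i]).
Local Open Scope complex_scope.
Import ComplexField.Normc.

Lemma normc_ge0 (z : R[i]) : 0 <= normc z.
Proof. by case: z => a b /=; rewrite sqrtr_ge0. Qed.

Lemma normc_sqr (z : R[i]) : normc z ^+ 2 = complex.Re z ^+ 2 + complex.Im z ^+ 2.
Proof. by case: z => a b /=; rewrite sqr_sqrtr// addr_ge0// sqr_ge0. Qed.

Lemma normc_real (x : R) : normc x%:C = `|x|.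
Proof. by rewrite /= expr0n addr0 sqrtr_sqr. Qed.

Lemma normcX (z : R[i]) n : normc (z ^+ n) = normc z ^+ n.
Proof. by elim: n => [|n IH]; rewrite ?normc1// !exprS normcM IH. Qed.

Lemma normc_conj (z : R[i]) : normc z^* = normc z.
Proof. by case: z => a b /=; rewrite sqrrN. Qed.

Lemma le_normcB (z w : R[i]) : normc z - normc w <= normc (z - w).
Proof. by rewrite lerBlDr -{1}(subrK w z) le_normcD. Qed.

Lemma normc_sum_le (I : Type) (r : seq I) (P : pred I) (F : I -> R[i]) :
  normc (\sum_(i <- r | P i) F i) <= \sum_(i <- r | P i) normc (F i).
Proof.
elim/big_ind2 : _ => [|x1 x2 y1 y2 h1 h2|//]; first by rewrite normc0.
by rewrite (le_trans (le_normcD _ _))// lerD.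
Qed.

(** Integrates a remainder estimate once, by the mean value theorem [f u = g c * u]. The factor
    [1 / (n + 1)] is given up, as only the order in [u] matters. *)
Lemma taylor_step (f g : R -> R) (K L : R) (n : nat) :
  (forall u : R, is_derive u 1 f (g u)) -> f 0 = 0 ->
  (forall u : R, `|u| <= L -> `|g u| <= K * `|u| ^+ n) ->
  forall u : R, `|u| <= L -> `|f u| <= K * `|u| ^+ n.+1.
Proof.
move=> df f0 gK u uL.
have cf : continuous f.
  by move=> x; apply: differentiable_continuous; apply/derivable1_diffP; have [] := df x.
have K0 (x : R) : `|x| <= L -> x != 0 -> 0 <= K.
  move=> xL x0; have := le_trans (normr_ge0 _) (gK _ xL).
  by rewrite pmulr_lge0// exprn_gt0// normr_gt0.
have key (c : R) : `|c| <= `|u| -> f u = g c * u -> `|f u| <= K * `|u| ^+ n.+1.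
  move=> cu ->; have [->|un0] := eqVneq u 0.
    by rewrite mulr0 normr0 expr0n mulr0.
  rewrite normrM exprSr mulrA ler_wpM2r//.
  rewrite (le_trans (gK _ (le_trans cu uL)))// ler_wpM2l//; first exact: K0 uL un0.
  by rewrite lerXn2r ?nnegrE.
have [u0|u0] := leP 0 u.
  have [c] := MVT_segment u0 (fun x _ => df x) (continuous_subspaceT cf).
  rewrite in_itv/= f0 !subr0 => /andP[c0 cu]; apply: key.
  by rewrite !ger0_norm.
have [c] := MVT_segment (ltW u0) (fun x _ => df x) (continuous_subspaceT cf).
rewrite in_itv/= f0 !sub0r mulrN => /andP[uc c0] /oppr_inj; apply: key.
by rewrite !ler0_norm ?lerN2// ltW.
Qed.

Lemma is_derive_half_sqr (u : R) : is_derive u 1 (fun v : R => v ^+ 2 / 2) u.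
Proof.
have -> : (fun v : R => v ^+ 2 / 2) = (2^-1 : R) \*: (@id R ^+ 2).
  by apply/funext => v; rewrite mulrC.
by apply: is_derive_eq; rewrite /GRing.scale/= expr1; field.
Qed.

Lemma expR_taylor (L : R) : exists2 K, 0 <= K & forall u : R, `|u| <= L ->
  `|expR u - 1 - u - u ^+ 2 / 2| <= K * `|u| ^+ 3.
Proof.
exists (expR L); first exact: expR_ge0.
have s0 (u : R) : `|u| <= L -> `|expR u| <= expR L * `|u| ^+ 0.
  by move=> uL; rewrite expr0 mulr1 ger0_norm ?expR_ge0// ler_expR (le_trans (ler_norm _)).
have s1 : forall u : R, `|u| <= L -> `|expR u - 1| <= expR L * `|u| ^+ 1.
  apply: taylor_step s0; last by rewrite expR0 subrr.
  by move=> u; apply: is_derive_eq; rewrite subr0.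
have s2 : forall u : R, `|u| <= L -> `|expR u - 1 - u| <= expR L * `|u| ^+ 2.
  apply: taylor_step s1; last by rewrite expR0 subrr subr0.
  by move=> u; apply: is_derive_eq; rewrite subr0.
apply: taylor_step s2; last by rewrite expR0; ring.
by move=> u; have := is_derive_half_sqr u => du; apply: is_derive_eq; rewrite subr0.
Qed.

(** The remainder of the cosine has order 4; one factor [|u|] is traded for [L] so that all the
    remainders have the same order 3. *)
Lemma sin_cos_taylor (L u : R) : `|u| <= L ->
  `|sin u - u| <= `|u| ^+ 3 /\ `|cos u - 1 + u ^+ 2 / 2| <= L * `|u| ^+ 3.
Proof.
have s0 (v : R) : `|v| <= L -> `|cos v| <= 1 * `|v| ^+ 0.
  by rewrite expr0 mulr1 cos_max.
have s1 : forall v : R, `|v| <= L -> `|sin v| <= 1 * `|v| ^+ 1.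
  by apply: taylor_step s0; last exact: sin0.
have s2 : forall v : R, `|v| <= L -> `|cos v - 1| <= 1 * `|v| ^+ 2.
  move=> v vL; rewrite -normrN; move: v vL.
  apply: taylor_step s1; last by rewrite cos0 subrr oppr0.
  by move=> v; apply: is_derive_eq; rewrite subr0 opprK.
have s3 : forall v : R, `|v| <= L -> `|sin v - v| <= 1 * `|v| ^+ 3.
  by apply: taylor_step s2; last by rewrite sin0 subrr.
have s4 : forall v : R, `|v| <= L -> `|cos v - 1 + v ^+ 2 / 2| <= 1 * `|v| ^+ 4.
  move=> v vL; rewrite -normrN; move: v vL.
  apply: taylor_step s3; last by rewrite cos0; ring.
  move=> v; have dv := is_derive_half_sqr v; apply: is_derive_eq.
  by rewrite subr0 opprD opprK.
move=> uL; split; first by rewrite -[leRHS]mul1r s3.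
rewrite (le_trans (s4 _ uL))// mul1r exprS ler_wpM2r//.
Qed.

(** Exchanging the factors one at a time leaves four differences, each with three other factors
    bounded by [B]. *)
Lemma normc_prod4_perturb (f g : 'I_4 -> R[i]) (B d : R) : 0 <= d ->
  (forall j, normc (f j) <= B) -> (forall j, normc (g j) <= B) ->
  (forall j, normc (g j - f j) <= d) ->
  normc (\prod_j g j - \prod_j f j) <= 4 * B ^+ 3 * d.
Proof.
move=> d0 fB gB fg; have B0 : 0 <= B := le_trans (normc_ge0 _) (fB ord0).
rewrite !big_ord_recl !big_ord0 !mulr1.
set g0 := g _; set g1 := g _; set g2 := g _; set g3 := g _.
set f0 := f _; set f1 := f _; set f2 := f _; set f3 := f _.
have -> : g0 * (g1 * (g2 * g3)) - f0 * (f1 * (f2 * f3)) =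
  (g0 - f0) * (g1 * (g2 * g3)) + (g1 - f1) * (f0 * (g2 * g3)) +
  (g2 - f2) * (f0 * (f1 * g3)) + (g3 - f3) * (f0 * (f1 * f2)) by ring.
have b (x y z w : R[i]) : normc x <= d -> normc y <= B -> normc z <= B ->
    normc w <= B -> normc (x * (y * (z * w))) <= B ^+ 3 * d.
  move=> xd yB zB wB; rewrite !normcM mulrC.
  apply: ler_pM; rewrite ?mulr_ge0 ?normc_ge0//.
  rewrite !exprS expr0 mulr1; apply: ler_pM; rewrite ?mulr_ge0 ?normc_ge0//.
  by apply: ler_pM; rewrite ?normc_ge0.
rewrite (_ : 4 * B ^+ 3 * d = B ^+ 3 * d + B ^+ 3 * d + B ^+ 3 * d + B ^+ 3 * d); last by ring.
do 3 (rewrite (le_trans (le_normcD _ _))// lerD//;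
  last by apply: b; (exact: fg || exact: fB || exact: gB)).
by apply: b; (exact: fg || exact: fB || exact: gB).
Qed.

(** The steps h, ih, -h, -ih; written with powers of i so that products over them reduce by i^2 =
    -1. *)
Definition cardinal4 h (j : 'I_4) : R[i] := h%:C * 'i%C ^+ j.

(** The product is invariant under h -> ih, so it depends on h only through h^4: it is D^4 + O(h^4),
    without terms of order 1 to 3. *)
Lemma prod_cardinal4 D h (a b : R[i]) :
  \prod_j (D%:C + cardinal4 h j * a + cardinal4 h j ^+ 2 * b) =
  (D%:C ^+ 2 + h%:C ^+ 4 * b ^+ 2) ^+ 2 - h%:C ^+ 4 * (2 * D%:C * b - a ^+ 2) ^+ 2.
Proof.
have i2 := sqr_i R.
rewrite !big_ord_recl !big_ord0 /cardinal4 /= /bump /= !mulr1.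
rewrite !addn0 !add1n; move: ('i%C : R[i]) i2 h%:C D%:C => I i2 H E.
have i3 : I ^+ 3 = - I by rewrite exprS i2 mulrN1.
rewrite i2 i3; ring: i2.
Qed.

End FourPoints.

Section FourPointInequality.
Variable R : realType.
Local Open Scope complex_scope.
Import ComplexField.Normc.

Lemma powR_ge_ln (D q y : R) : 0 < D -> 0 < y ->
  D `^ q * (1 + q * ln (y / D)) <= y `^ q.
Proof.
move=> D0 y0; have -> : y `^ q = D `^ q * (y / D) `^ q.
  by rewrite -powRM ?ltW// ?divr_gt0// mulrCA divff ?gt_eqF// mulr1.
rewrite ler_wpM2l ?powR_ge0// /powR gt_eqF ?divr_gt0//.
exact: expR_ge1Dx.
Qed.

(** The tangent bound [powR_ge_ln] turns the sum of powers into a sum of logarithms, hence into the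
    logarithm of the product, which is at least ln(1 - s) >= - s / (1 - s) >= - 2 s for s = d / D^4
    <= 1/2. *)
Lemma sum4_powR_ge (D q d a1 a2 a3 a4 : R) : 0 < D -> 0 < q ->
  0 <= d -> d <= D ^+ 4 / 2 ->
  0 < a1 -> 0 < a2 -> 0 < a3 -> 0 < a4 -> D ^+ 4 - d <= a1 * a2 * a3 * a4 ->
  4 * D `^ q - 2 * q * D `^ q * d / D ^+ 4 <= a1 `^ q + a2 `^ q + a3 `^ q + a4 `^ q.
Proof.
move=> D0 q0 d0 dD h1 h2 h3 h4 hp.
have D40 : 0 < D ^+ 4 by rewrite exprn_gt0.
have s0 : 0 <= d / D ^+ 4 by rewrite divr_ge0// ltW.
have s1 : d / D ^+ 4 <= 2^-1 by rewrite ler_pdivrMr// mulrC.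
have Hln : - (2 * (d / D ^+ 4)) <=
    ln (a1 / D) + ln (a2 / D) + ln (a3 / D) + ln (a4 / D).
  set s := d / D ^+ 4 in s0 s1 *.
  have E : ln (a1 / D) + ln (a2 / D) + ln (a3 / D) + ln (a4 / D) =
      ln (a1 * a2 * a3 * a4 / D ^+ 4).
    rewrite !ln_div ?posrE ?mulr_gt0 ?exprn_gt0// lnXn//.
    by rewrite (lnM (x := a1 * a2 * a3)) ?lnM ?posrE ?mulr_gt0//; ring.
  have s2 : 0 < 1 - s by lra.
  rewrite E (@le_trans _ _ (ln (1 - s)))//; last first.
    rewrite ler_ln ?posrE//; last by rewrite divr_gt0 ?mulr_gt0.
    rewrite ler_pdivlMr// mulrBl mul1r /s divfK ?gt_eqF//.
  rewrite -[1 - s]invrK lnV ?posrE ?invr_gt0// lerN2.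
  rewrite -[(1 - s)^-1](subrKC 1) (le_trans (le_ln1Dx _))//.
    by rewrite ltrBrDl subrr invr_gt0.
  rewrite lerBlDl -[(1 - s)^-1]mul1r ler_pdivrMr//; nra.
have := powR_ge_ln q D0 h1; have := powR_ge_ln q D0 h2.
have := powR_ge_ln q D0 h3; have := powR_ge_ln q D0 h4.
have P : q * D `^ q * (- (2 * (d / D ^+ 4))) <=
   q * D `^ q * (ln (a1 / D) + ln (a2 / D) + ln (a3 / D) + ln (a4 / D)).
  by rewrite ler_wpM2l// mulr_ge0 ?powR_ge0// ltW.
move: P; set e := d / D ^+ 4.
rewrite (_ : 2 * q * D `^ q * d / D ^+ 4 = q * D `^ q * (2 * e)); last by rewrite /e; ring.
move=> P Q1 Q2 Q3 Q4; apply: le_trans (lerD (lerD (lerD Q4 Q3) Q2) Q1).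
apply: (@le_trans _ _ (4 * D `^ q +
  q * D `^ q * (ln (a1 / D) + ln (a2 / D) + ln (a3 / D) + ln (a4 / D)))).
  by rewrite lerD2l// -mulrN.
by rewrite le_eqVlt; apply/orP; left; apply/eqP; ring.
Qed.

(** Cauchy-Schwarz for the vectors (v, sqrt e) and (w, sqrt e) of C^2; the two sides differ by e |v
    - w|^2. *)
Lemma normc_cauchy_schwarz (e : R) (v w : R[i]) : 0 <= e ->
  normc (v * w^* + e%:C) ^+ 2 <= (normc v ^+ 2 + e) * (normc w ^+ 2 + e).
Proof.
move=> e0; rewrite !normc_sqr; case: v => v1 v2; case: w => w1 w2 /=.
rewrite -subr_ge0.
rewrite [leRHS](_ : _ = e * ((v1 - w1) ^+ 2 + (v2 - w2) ^+ 2)); last by ring.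
by rewrite mulr_ge0// addr_ge0// sqr_ge0.
Qed.

Lemma normc_cardinal4 (h : R) j : 0 <= h -> normc (cardinal4 h j) = h.
Proof.
move=> h0; rewrite normcM normc_real ger0_norm// normcX.
by rewrite (_ : normc 'i%C = 1) ?expr1n ?mulr1//= expr0n expr1n add0r sqrtr1.
Qed.

(* With D = |w|^2 + e and E_j the value at the j-th point, Cauchy-Schwarz gives
   (|E_j|^2 + e) D >= |E_j w^* + e|^2, and the product over the four directions of
   E_j w^* + e is D^4 + O(h^3); the regularization e > 0 keeps D away from 0. *)
Lemma four_point (K e q : R) : 0 <= K -> 0 < e -> 0 < q ->
  exists C h0 : R, [/\ 0 <= C, 0 < h0 &
  forall (h : R) (w A B : R[i]) (r : 'I_4 -> R[i]), 0 < h <= h0 ->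
    normc w <= K -> normc A <= K -> normc B <= K ->
    (forall j, normc (r j) <= K * h ^+ 3) ->
    4 * (normc w ^+ 2 + e) `^ q - C * h ^+ 3 <=
    \sum_j (normc (w + cardinal4 h j * A + cardinal4 h j ^+ 2 * B + r j) ^+ 2 + e) `^ q].
Proof.
move=> K0 e0 q0.
pose M := 4 * K ^+ 2 + e.
have K20 : 0 <= K ^+ 2 by rewrite exprn_ge0.
have M0 : 0 < M by rewrite /M; lra.
(* 12 for the distance from the product of the [F j] to D^4, and 4 for the passage from [F] to [G];
   [M] dominates D, [F], [G], [a] and [b]. *)
pose C3 := 16 * M ^+ 4.
have C30 : 0 < C3 by rewrite mulr_gt0// exprn_gt0.
have e40 : 0 < e ^+ 4 by rewrite exprn_gt0.
(* The bound on h gives 4 C3 h^3 <= e^4 <= D^4, so that the defect 2 C3 h^3 of the product is at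
   most D^4 / 2, as [sum4_powR_ge] demands. *)
exists (2 * q * M `^ q * (2 * C3) / e ^+ 4), (Num.min 1 (e ^+ 4 / (4 * C3))); split.
- apply: divr_ge0; last exact: ltW.
  by rewrite !mulr_ge0 ?powR_ge0//; exact: ltW.
- by rewrite lt_min ltr01/= divr_gt0// mulr_gt0.
move=> h w A B r /andP[h0]; rewrite le_min => /andP[h1 hC] wK AK BK rK.
have {}hC : 4 * C3 * h <= e ^+ 4 by rewrite mulrC -ler_pdivlMr// mulr_gt0.
have h0' := ltW h0; 
have h3h : h ^+ 3 <= h by rewrite exprS ler_piMr// exprn_ile1.
have h30 : 0 <= h ^+ 3 by rewrite exprn_ge0.
have h2 : h ^+ 2 <= 1 by rewrite exprn_ile1.
have w0 := normc_ge0 w; have A0 := normc_ge0 A; have B0 := normc_ge0 B.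
pose D := normc w ^+ 2 + e.
have w2K : normc w ^+ 2 <= K ^+ 2 by rewrite lerXn2r ?nnegrE.
have D0 : 0 < D by rewrite ltr_wpDl// sqr_ge0.
have eD : e <= D by rewrite lerDr sqr_ge0.
have DM : D <= M by rewrite /D /M; lra.
have De4 : e ^+ 4 <= D ^+ 4 by rewrite lerXn2r ?nnegrE// ?(ltW D0)// ltW.
pose E j := w + cardinal4 h j * A + cardinal4 h j ^+ 2 * B + r j.
pose a := A * w^*; pose b := B * w^*.
have aK : normc a <= K ^+ 2 by rewrite normcM normc_conj expr2 ler_pM.
have bK : normc b <= K ^+ 2 by rewrite normcM normc_conj expr2 ler_pM.
have a0 := normc_ge0 a; have b0 := normc_ge0 b.
(* [F] is [G] without the remainder [r], in the form computed by [prod_cardinal4]. *)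
pose F j := D%:C + cardinal4 h j * a + cardinal4 h j ^+ 2 * b.
pose G j := E j * w^* + e%:C.
have DE : D%:C = w * w^* + e%:C.
  rewrite /D normc_sqr; case: (w) => x y /=.
  by apply/eqP; rewrite eq_complex /=; apply/andP; split; apply/eqP; ring.
have GF j : G j - F j = r j * w^* by rewrite /G /F /E DE /a /b; ring.
have GFn j : normc (G j - F j) <= K ^+ 2 * h ^+ 3.
  rewrite GF normcM normc_conj expr2 (mulrC _ (normc w)) -mulrA.
  by rewrite ler_pM ?normc_ge0.
have Fn j : normc (F j) <= K ^+ 2 * 3 + e.
  rewrite (le_trans (le_normcD _ _))// (_ : _ + e = (K ^+ 2 + e + K ^+ 2) + K ^+ 2); last by ring.
  rewrite lerD//; last first.
    rewrite normcM normcX normc_cardinal4//; nra.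
  rewrite (le_trans (le_normcD _ _))// lerD//.
    by rewrite normc_real gtr0_norm// /D lerD2r.
  rewrite normcM normc_cardinal4//; nra.
have FM j : normc (F j) <= M by rewrite (le_trans (Fn j))// /M; lra.
have GM j : normc (G j) <= M.
  rewrite -(subrK (F j) (G j)) (le_trans (le_normcD _ _))//.
  have := GFn j; have := Fn j; rewrite /M => u v.
  have : K ^+ 2 * h ^+ 3 <= K ^+ 2 by rewrite ler_piMr// (le_trans h3h).
  by move: u v; lra.
have prodG : D ^+ 4 - C3 * h ^+ 3 <= normc (\prod_j G j).
  have P1 := normc_prod4_perturb (mulr_ge0 K20 h30) FM GM GFn.
  have P2 : normc (\prod_j F j - D%:C ^+ 4) <= 12 * M ^+ 4 * h ^+ 3.
    rewrite prod_cardinal4.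
    rewrite (_ : _ - _ = h%:C ^+ 4 * (2 * (D%:C ^+ 2 * b ^+ 2) + h%:C ^+ 4 * b ^+ 4
       - (2 * (D%:C * b) - a ^+ 2) ^+ 2)); last by ring.
    have aM : normc a <= M by rewrite (le_trans aK)// /M; lra.
    have bM : normc b <= M by rewrite (le_trans bK)// /M; lra.
    have nD : normc D%:C = D by rewrite normc_real gtr0_norm.
    have nh : normc h%:C = h by rewrite normc_real gtr0_norm.
    have n2 : normc (2 : R[i]) = 2.
      by rewrite -(rmorph_nat (real_complex R) 2) normc_real ger0_norm.
    rewrite normcM normcX nh.
    have h4 : h ^+ 4 <= h ^+ 3 by rewrite [leLHS]exprS ler_piMl.
    have hh : h ^+ 4 <= 1 by rewrite exprn_ile1.
    have Da : normc (D%:C ^+ 2 * b ^+ 2) <= M ^+ 4.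
      rewrite normcM !normcX nD -[4%N]/(2 + 2)%N exprD.
      by rewrite ler_pM ?exprn_ge0// ?lerXn2r ?nnegrE// ltW.
    have Db : normc (D%:C * b) <= M ^+ 2 by rewrite normcM nD expr2 ler_pM// ltW.
    have a2 : normc (a ^+ 2) <= M ^+ 2 by rewrite normcX lerXn2r ?nnegrE// ltW.
    have b4 : normc (h%:C ^+ 4 * b ^+ 4) <= M ^+ 4.
      rewrite normcM !normcX nh -[leRHS]mul1r ler_pM ?exprn_ge0//.
      by rewrite lerXn2r ?nnegrE// ltW.
    have sq : normc ((2 * (D%:C * b) - a ^+ 2) ^+ 2) <= 9 * M ^+ 4.
      rewrite normcX (_ : 9 * M ^+ 4 = (3 * M ^+ 2) ^+ 2); last by ring.
      rewrite lerXn2r ?nnegrE ?normc_ge0 ?mulr_ge0 ?exprn_ge0 ?(ltW M0)//.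
      by rewrite (le_trans (le_normcD _ _))// normcN normcM n2; lra.
    rewrite mulrC ler_pM ?normc_ge0 ?exprn_ge0//.
    rewrite (le_trans (le_normcD _ _))// normcN.
    have := le_normcD (2 * (D%:C ^+ 2 * b ^+ 2)) (h%:C ^+ 4 * b ^+ 4).
    by rewrite [X in _ <= X + _]normcM n2; lra.
  have P3 : 4 * M ^+ 3 * (K ^+ 2 * h ^+ 3) <= 4 * M ^+ 4 * h ^+ 3.
    rewrite mulrA ler_wpM2r// -mulrA ler_wpM2l// [leRHS]exprSr ler_wpM2l ?exprn_ge0 ?(ltW M0)//.
    by rewrite /M; lra.
  have := le_normcB (\prod_j F j) (\prod_j F j - \prod_j G j).
  have := le_normcB (D%:C ^+ 4) (D%:C ^+ 4 - \prod_j F j).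
  rewrite !subKr normcX normc_real gtr0_norm// -(normcN (_ - \prod_j F j)).
  rewrite -(normcN (_ - \prod_j G j)) !opprB /C3; lra.
pose Y j := normc (E j) ^+ 2 + e.
have Y0 j : 0 < Y j by rewrite ltr_wpDl// sqr_ge0.
have CS j : normc (G j) ^+ 2 <= Y j * D by apply: normc_cauchy_schwarz; exact: ltW.
pose c := C3 * h ^+ 3.
have c0 : 0 <= c by rewrite mulr_ge0// ltW.
have cD : 4 * c <= D ^+ 4.
  rewrite (le_trans _ De4)// (le_trans _ hC)// /c mulrA ler_wpM2l// mulr_ge0// ltW//.
have D40 : 0 < D ^+ 4 by rewrite exprn_gt0.
(* Multiplied by D^4, the right-hand side dominates the squared modulus of the product of the [G j],
   hence (D^4 - c)^2 >= D^4 (D^4 - 2 c). *)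
have prodY : D ^+ 4 - 2 * c <= Y ord0 * Y (lift ord0 ord0) *
    Y (lift ord0 (lift ord0 ord0)) * Y (lift ord0 (lift ord0 (lift ord0 ord0))).
  rewrite -(ler_pM2r D40).
  apply: (@le_trans _ _ (normc (\prod_j G j) ^+ 2)).
    apply: (@le_trans _ _ ((D ^+ 4 - c) ^+ 2)).
      by rewrite -subr_ge0 (_ : _ - _ = c ^+ 2) ?sqr_ge0//; ring.
    rewrite lerXn2r ?nnegrE ?normc_ge0//; first by rewrite subr_ge0; lra.
  rewrite !big_ord_recl big_ord0 mulr1 !normcM !exprMn.
  rewrite (_ : _ * D ^+ 4 = Y ord0 * D * (Y (lift ord0 ord0) * D *
    (Y (lift ord0 (lift ord0 ord0)) * D *
    (Y (lift ord0 (lift ord0 (lift ord0 ord0))) * D)))); last by ring.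
  apply: ler_pM; [exact: sqr_ge0|by rewrite !mulr_ge0 ?sqr_ge0 ?normc_ge0|exact: CS|].
  apply: ler_pM; [exact: sqr_ge0|by rewrite !mulr_ge0 ?sqr_ge0 ?normc_ge0|exact: CS|].
  by apply: ler_pM; rewrite ?sqr_ge0 ?CS.
have d0 : 0 <= 2 * c by rewrite mulr_ge0.
have dD : 2 * c <= D ^+ 4 / 2 by lra.
have main := sum4_powR_ge D0 q0 d0 dD (Y0 _) (Y0 _) (Y0 _) (Y0 _) prodY.
rewrite !big_ord_recl big_ord0 addr0 !addrA; apply: le_trans main.
rewrite -/D lerD2l lerN2.
have DqM : D `^ q <= M `^ q by apply: ge0_ler_powR; rewrite ?nnegrE//; exact: ltW.
rewrite (_ : 2 * q * M `^ q * (2 * C3) / e ^+ 4 * h ^+ 3 =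
  2 * q * (2 * c) * (M `^ q / e ^+ 4)); last by rewrite /c; ring.
rewrite (_ : 2 * q * D `^ q * (2 * c) / D ^+ 4 = 2 * q * (2 * c) * (D `^ q / D ^+ 4)); last by ring.
rewrite ler_wpM2l//; first by rewrite !mulr_ge0// ltW.
by rewrite ler_pM ?powR_ge0 ?invr_ge0 ?(ltW D40)// lef_pV2.
Qed.

End FourPointInequality.

(** * Bounded approximately convex functions *)

Section ApproximatelyConvex.
Variable R : realType.

(** Increments grow, so each of the [k] consecutive blocks of length [n] gains at least as much as
    the first one. *)
Lemma convex_seq_le (v : nat -> R) (n k : nat) :
  (forall i, 2 * v i.+1 <= v i.+2 + v i) ->
  k%:R * (v n - v 0%N) <= v (n * k)%N - v 0%N.
Proof.
move=> cv.
have step i j : v i.+1 - v i <= v (i + j).+1 - v (i + j)%N.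
  elim: j => [|j IH]; first by rewrite addn0.
  by rewrite addnS; have := cv (i + j)%N; lra.
have block j : v n - v 0%N <= v (n + j)%N - v j.
  elim: n => [|n' IH]; first by rewrite add0n !subrr.
  by have := step n' j; rewrite addSn; lra.
elim: k => [|k IH]; first by rewrite mul0r muln0 subrr.
by rewrite mulnS -(natr1 k); have := block (n * k)%N; lra.
Qed.

(** If [m x] exceeded [m 0], convexity would make [m (k x)] grow linearly in [k], against the bound
    [B]. For each [k] the step [h = x / n] is taken so fine that the accumulated defect up to [k x]
    stays below 1. *)
Lemma almost_convex_bounded_le (m : R -> R) (C h0 B : R) : 0 <= C -> 0 < h0 ->
  (forall x, 0 <= x -> `|m x| <= B) ->
  (forall h x, 0 < h <= h0 -> h <= x ->
     2 * m x - C * h ^+ 3 <= m (x + h) + m (x - h)) ->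
  forall x, 0 <= x -> m x <= m 0.
Proof.
move=> C0 h00 mB mC x; rewrite le_eqVlt => /predU1P[<-//|x0].
have key (k : nat) : k%:R * (m x - m 0) <= 2 * B + 1.
  (* For [n > b], the first summand ensures [h <= h0], the second that the quadratic correction at
     [k x] is at most 1. *)
  pose b := x / h0 + C * x ^+ 3 * k%:R ^+ 2.
  have x30 : 0 <= x ^+ 3 by rewrite exprn_ge0// ltW.
  have xh0 : 0 <= x / h0 by rewrite divr_ge0// ltW.
  have b2 : 0 <= C * x ^+ 3 * k%:R ^+ 2 by exact: mulr_ge0 (mulr_ge0 C0 x30) (sqr_ge0 _).
  pose n := (Num.trunc b).+1.
  have bn : b < n%:R by rewrite truncnS_gt.
  have n0 : 0 < n%:R :> R by rewrite ltr0n.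
  pose h := x / n%:R.
  have h0' : 0 < h by rewrite divr_gt0.
  have hh0 : h <= h0.
    by rewrite ler_pdivrMr// mulrC -ler_pdivrMr// (le_trans _ (ltW bn))// /b lerDl.
  have nh : n%:R * h = x by rewrite /h mulrC divfK ?gt_eqF.
  (* The quadratic term absorbs the defect C h^3, making [v] exactly convex. *)
  pose v (i : nat) := m (i%:R * h) + C * h / 2 * (i%:R * h) ^+ 2.
  have cv i : 2 * v i.+1 <= v i.+2 + v i.
    have hx : h <= i.+1%:R * h by rewrite ler_peMl ?(ltW h0')// ler1n.
    have := mC h (i.+1%:R * h); rewrite h0' hh0 => /(_ isT hx).
    rewrite (_ : i.+1%:R * h + h = i.+2%:R * h); last by rewrite -(natr1 i.+1); ring.
    rewrite (_ : i.+1%:R * h - h = i%:R * h); last by rewrite -(natr1 i); ring.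
    rewrite /v -(natr1 i.+1) -(natr1 i).
    move: (m _) (m _) (m _) => m1 m2 m3.
    set Z := C * h ^+ 3.
    have -> : C * h / 2 * ((i%:R + 1 + 1) * h) ^+ 2 =
      C * h / 2 * (2 * ((i%:R + 1) * h) ^+ 2 - (i%:R * h) ^+ 2) + Z by rewrite /Z; field.
    by lra.
  have nkh : (n * k)%N%:R * h = x * k%:R by rewrite natrM mulrAC nh.
  have V := convex_seq_le n k cv; rewrite /v nkh nh mul0r expr0n mulr0 addr0 in V.
  have P : C * h / 2 * (x * k%:R) ^+ 2 <= 1.
    rewrite (_ : _ * _ ^+ 2 = C * x ^+ 3 * k%:R ^+ 2 / n%:R / 2); last first.
      by rewrite /h; field; rewrite gt_eqF.
    have : C * x ^+ 3 * k%:R ^+ 2 / n%:R <= 1.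
      by rewrite ler_pdivrMr// mul1r (le_trans _ (ltW bn))// /b lerDr.
    by move=> ?; lra.
  have Q : 0 <= k%:R * (C * h / 2 * x ^+ 2).
    by rewrite mulr_ge0// mulr_ge0 ?sqr_ge0// divr_ge0// mulr_ge0// ltW.
  have := mB 0 (lexx _); have : `|m (x * k%:R)| <= B by rewrite mB// mulr_ge0// ltW.
  rewrite !ler_norml => /andP[_ ?] /andP[? _]; move: V P Q.
  set X := C * h / 2 * x ^+ 2; set Y := C * h / 2 * _ ^+ 2 => V P Q.
  rewrite -(lerD2r (k%:R * X)) -mulrDr addrAC.
  by apply: (le_trans V); lra.
rewrite leNgt; apply/negP => lt0.
have d0 : 0 < m x - m 0 by rewrite subr_gt0.
have := key (Num.trunc ((2 * B + 1) / (m x - m 0))).+1.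
by rewrite leNgt -ltr_pdivrMr// truncnS_gt.
Qed.

End ApproximatelyConvex.

(** * General Dirichlet sums and their four-point inequality *)

Section GeneralDirichletSum.
Variable R : realType.
Local Open Scope complex_scope.
Import ComplexField.Normc.
Implicit Types (l h : R) (s z : R[i]).

(** exp(- l s) for an arbitrary real frequency [l]; at [l = ln n] it unfolds to the same expression
    as [npow_opp n s]. *)
Definition cexp l s : R[i] :=
  (expR (- (complex.Re s * l)))%:C *
  (cos (complex.Im s * l) -i* sin (complex.Im s * l)).

Lemma cexpD l s z : cexp l (s + z) = cexp l s * cexp l z.
Proof.
case: s => a b; case: z => c d; rewrite /cexp /=.
rewrite !mulrDl opprD expRD cosD sinD.
by apply/eqP; rewrite eq_complex /=; apply/andP; split; apply/eqP; ring.
Qed.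

Lemma normc_cexp l s : normc (cexp l s) = expR (- (complex.Re s * l)).
Proof.
rewrite normcM normc_real ger0_norm ?expR_ge0//=.
by rewrite sqrrN cos2Dsin2 sqrtr1 mulr1.
Qed.

Lemma normc_cexp_le1 l s : 0 <= l -> 0 <= complex.Re s -> normc (cexp l s) <= 1.
Proof. by move=> l0 s0; rewrite normc_cexp expR_le1 oppr_le0 mulr_ge0. Qed.

Lemma normc_le_ReIm (a b : R) : normc (a +i* b) <= `|a| + `|b|.
Proof.
rewrite -ler_sqr ?nnegrE ?normc_ge0 ?addr_ge0// normc_sqr/= sqrrD !real_normK ?num_real//.
by rewrite lerD2r lerDl mulrn_wge0// mulr_ge0.
Qed.

Lemma cardinal4E h j :
  cardinal4 h j = nth 0 [:: h +i* 0; 0 +i* h; (- h) +i* 0; 0 +i* (- h)] j.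
Proof.
rewrite /cardinal4; case: j => -[|[|[|[|//]]]] jlt /=.
- by rewrite expr0 mulr1.
- by rewrite expr1; apply/eqP; rewrite eq_complex /= !(mul0r, mulr0, mulr1, subr0, addr0) !eqxx.
- by rewrite sqr_i mulrN1 ; apply/eqP; rewrite eq_complex /= oppr0 !eqxx.
- by rewrite exprS sqr_i; apply/eqP; rewrite eq_complex /=; apply/andP; split; apply/eqP; ring.
Qed.

Lemma cexp_taylor (L : R) : 0 <= L -> exists2 K, 0 <= K & forall l h j,
  0 <= l <= L -> 0 < h <= 1 ->
  normc (cexp l (cardinal4 h j) -
    (1 + cardinal4 h j * (- l)%:C + cardinal4 h j ^+ 2 * (l ^+ 2 / 2)%:C)) <= K * h ^+ 3.
Proof.
move=> L0; have [K1 K10 eK] := expR_taylor L.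
(* [K1] serves the horizontal steps, where [cexp] is a real exponential, and [L + 1] the vertical
   ones, where a cosine and a sine remainder add up; [L ^+ 3] comes from (l h)^3 <= L^3 h^3. *)
exists ((K1 + L + 1) * L ^+ 3) => [|l h j /andP[l0 lL] /andP[h0 h1]].
  by rewrite mulr_ge0 ?exprn_ge0 ?addr_ge0.
have u0 : 0 <= l * h by rewrite mulr_ge0// ltW.
have uL : l * h <= L by rewrite -[leRHS]mulr1 ler_pM// ltW.
have u3 : (l * h) ^+ 3 <= L ^+ 3 * h ^+ 3.
  by rewrite exprMn ler_wpM2r ?exprn_ge0 ?(ltW h0)// lerXn2r ?nnegrE.
have absu : `|l * h| = l * h by rewrite ger0_norm.
have bnd (k : R) : 0 <= k -> k <= K1 + L + 1 -> forall x, x <= k * (l * h) ^+ 3 ->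
    x <= (K1 + L + 1) * L ^+ 3 * h ^+ 3.
  move=> k0 kK x /le_trans; apply; rewrite -mulrA ler_pM// exprn_ge0//.
have [Sp Cp] := @sin_cos_taylor R L (l * h) (eq_ind_r (fun x => x <= L) uL absu).
have Ep := eK (l * h); have En := eK (- (l * h)).
rewrite normrN in En.
rewrite absu in Ep En Sp Cp.
have {Ep}Ep := Ep uL; have {En}En := En uL.
have cE (x y : R) (z : R[i]) : z = x +i* y -> forall k : R, 0 <= k -> k <= K1 + L + 1 ->
    `|x| + `|y| <= k * (l * h) ^+ 3 -> normc z <= (K1 + L + 1) * L ^+ 3 * h ^+ 3.
  by move=> -> k k0 kK xy; rewrite (le_trans (normc_le_ReIm _ _))// (bnd k).
have u30 : 0 <= (l * h) ^+ 3 by rewrite exprn_ge0.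
case: j => -[|[|[|[|//]]]] jlt;
  have zE := cardinal4E h (Ordinal jlt); rewrite {}zE [nth _ _ _]/=.
- apply: (cE (expR (- (l * h)) - 1 - (- (l * h)) - (- (l * h)) ^+ 2 / 2) 0 _ _ K1) => //.
  + rewrite /cexp/= !mul0r cos0 sin0 (mulrC h).
    by apply/eqP; rewrite eq_complex /=; apply/andP; split; apply/eqP; field.
  + by lra.
  + by rewrite normr0 addr0.
- apply: (cE (cos (l * h) - 1 + (l * h) ^+ 2 / 2) (- (sin (l * h) - l * h)) _ _ (L + 1)) => //.
  + rewrite /cexp/= !mul0r oppr0 expR0 (mulrC h).
    by apply/eqP; rewrite eq_complex /=; apply/andP; split; apply/eqP; field.
  + by lra.
  + by lra.
  + by rewrite normrN mulrDl mul1r lerD.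
- apply: (cE (expR (l * h) - 1 - (l * h) - (l * h) ^+ 2 / 2) 0 _ _ K1) => //.
  + rewrite /cexp/= !mul0r cos0 sin0 mulNr opprK (mulrC h).
    by apply/eqP; rewrite eq_complex /=; apply/andP; split; apply/eqP; field.
  + by lra.
  + by rewrite normr0 addr0.
- apply: (cE (cos (l * h) - 1 + (l * h) ^+ 2 / 2) (sin (l * h) - l * h) _ _ (L + 1)) => //.
  + rewrite /cexp/= !mul0r oppr0 expR0 mulNr cosN sinN (mulrC h).
    by apply/eqP; rewrite eq_complex /=; apply/andP; split; apply/eqP; field.
  + by lra.
  + by lra.
  + by rewrite mulrDl mul1r lerD.
Qed.

Definition gdsum (c : nat -> R[i]) (l : nat -> R) (m : nat) s : R[i] :=
  \sum_(1 <= n < m) c n * cexp (l n) s.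

Lemma normc_sum_weight_le (c w : nat -> R[i]) (m : nat) (k : R) :
  (forall n, (n < m)%N -> normc (w n) <= k) ->
  normc (\sum_(1 <= n < m) c n * w n) <= (\sum_(1 <= n < m) normc (c n)) * k.
Proof.
move=> wk; rewrite (le_trans (normc_sum_le _ _ _))// mulr_suml !big_nat.
apply: ler_sum => n /andP[_ nm].
by rewrite normcM ler_wpM2l ?normc_ge0// wk.
Qed.

Lemma normc_gdsum_le c (l : nat -> R) m s : (forall n, 0 <= l n) -> 0 <= complex.Re s ->
  normc (gdsum c l m s) <= \sum_(1 <= n < m) normc (c n).
Proof.
move=> l0 s0; rewrite -[leRHS]mulr1; apply: normc_sum_weight_le => n _.
exact: normc_cexp_le1.
Qed.

(** Factoring exp(- l s) out of each term leaves a Taylor expansion at 0. That factor has modulus at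
    most 1 when Re s >= 0, so the constants do not depend on s, even if s - h leaves the
    half-plane. *)
Lemma gdsum_four_point c (l : nat -> R) m (e q : R) : (forall n, 0 <= l n) -> 0 < e -> 0 < q ->
  exists C h0 : R, [/\ 0 <= C, 0 < h0 & forall h s, 0 < h <= h0 -> 0 <= complex.Re s ->
    4 * (normc (gdsum c l m s) ^+ 2 + e) `^ q - C * h ^+ 3 <=
    \sum_j (normc (gdsum c l m (s + cardinal4 h j)) ^+ 2 + e) `^ q].
Proof.
move=> l0 e0 q0; pose L := \sum_(n < m) l n.
have L0 : 0 <= L by apply: sumr_ge0.
have lL n : (n < m)%N -> l n <= L.
  by move=> nm; rewrite /L (bigD1 (Ordinal nm))//= lerDl sumr_ge0.
have [K K0 cK] := cexp_taylor L0.
pose S := \sum_(1 <= n < m) normc (c n).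
have S0 : 0 <= S by apply: sumr_ge0 => n _; exact: normc_ge0.
pose M := S * (1 + L + L ^+ 2 + K).
have L20 : 0 <= L ^+ 2 by rewrite exprn_ge0.
have M0 : 0 <= M by rewrite mulr_ge0// !addr_ge0.
have [C [h0 [C0 h00 H]]] := four_point M0 e0 q0.
exists C, (Num.min 1 h0); split => //; first by rewrite lt_min ltr01.
move=> h s /andP[hp]; rewrite le_min => /andP[h1 hh0] s0.
pose A := \sum_(1 <= n < m) c n * (cexp (l n) s * (- l n)%:C).
pose B := \sum_(1 <= n < m) c n * (cexp (l n) s * (l n ^+ 2 / 2)%:C).
pose T n j := cexp (l n) (cardinal4 h j) -
  (1 + cardinal4 h j * (- l n)%:C + cardinal4 h j ^+ 2 * (l n ^+ 2 / 2)%:C).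
pose r j := \sum_(1 <= n < m) c n * (cexp (l n) s * T n j).
have E j : gdsum c l m (s + cardinal4 h j) =
    gdsum c l m s + cardinal4 h j * A + cardinal4 h j ^+ 2 * B + r j.
  rewrite /gdsum /A /B /r !mulr_sumr -!big_split /=; apply: eq_bigr => n _.
  by rewrite cexpD /T; ring.
under eq_bigr do rewrite E.
have ce n : normc (cexp (l n) s) <= 1 by exact: normc_cexp_le1.
have W (w : nat -> R[i]) (k : R) : k <= 1 + L + L ^+ 2 + K ->
    (forall n, (n < m)%N -> normc (w n) <= k) ->
    normc (\sum_(1 <= n < m) c n * (cexp (l n) s * w n)) <= M.
  move=> kM wk; apply: (@le_trans _ _ (S * k)); last by rewrite ler_wpM2l.
  apply: normc_sum_weight_le => n nm; rewrite normcM -[k]mul1r.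
  by rewrite ler_pM ?normc_ge0// wk.
apply: H; first by rewrite hp.
- rewrite (le_trans (normc_gdsum_le _ _ l0 s0))// -[leLHS]mulr1 ler_wpM2l//.
  by rewrite -!addrA lerDl !addr_ge0.
- apply: (W _ L) => [|n nm]; first by lra.
  by rewrite normc_real normrN ger0_norm ?lL.
- apply: (W _ (L ^+ 2)) => [|n nm]; first by lra.
  rewrite normc_real ger0_norm; last by rewrite divr_ge0// exprn_ge0.
  have : l n ^+ 2 <= L ^+ 2 by rewrite lerXn2r ?nnegrE ?lL.
  by have := sqr_ge0 (l n); lra.
- move=> j; apply: (@le_trans _ _ (S * (K * h ^+ 3))).
    apply: normc_sum_weight_le => n nm; rewrite normcM -[leRHS]mul1r.
    by rewrite ler_pM ?normc_ge0// cK ?hp// l0 lL.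
  have h30 : 0 <= h ^+ 3 by rewrite exprn_ge0// ltW.
  by rewrite mulrA ler_wpM2r// /M ler_wpM2l// lerDr !addr_ge0.
Qed.

End GeneralDirichletSum.

(** * Monotonicity of the means *)

Section MonotoneMean.
Variable R : realType.
Local Open Scope complex_scope.
Import ComplexField.Normc.
Variables (c : nat -> R[i]) (l : nat -> R) (m : nat).
Hypothesis l0 : forall n, 0 <= l n.

Let S := \sum_(1 <= n < m) normc (c n).

Lemma trigpoly_Re_term (a : R[i]) (k x : R) :
  trigpoly (fun t => complex.Re (a * cexp k (x +i* t))).
Proof.
have -> : (fun t => complex.Re (a * cexp k (x +i* t))) =
  (fun t => wave (complex.Re a * expR (- (x * k))) k 0 t +
            wave (complex.Im a * expR (- (x * k))) k (- (pi / 2)) t).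
  apply/funext => t; rewrite /wave addr0 cosBpihalf /cexp /=; case: a => a1 a2 /=.
  by rewrite (mulrC t); ring.
by apply: TrigAdd; exact: TrigWave.
Qed.

Lemma trigpoly_Im_term (a : R[i]) (k x : R) :
  trigpoly (fun t => complex.Im (a * cexp k (x +i* t))).
Proof.
have -> : (fun t => complex.Im (a * cexp k (x +i* t))) =
  (fun t => wave (complex.Im a * expR (- (x * k))) k 0 t +
            wave (- complex.Re a * expR (- (x * k))) k (- (pi / 2)) t).
  apply/funext => t; rewrite /wave addr0 cosBpihalf /cexp /=; case: a => a1 a2 /=.
  by rewrite (mulrC t); ring.
by apply: TrigAdd; exact: TrigWave.
Qed.

(** The square of the modulus, Re^2 + Im^2, is itself a trigonometric polynomial; this is why powers
    of exponent p/2 of the square are used throughout. *)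
Lemma uap_gdsum (x : R) : uap (fun t => normc (gdsum c l m (x +i* t)) ^+ 2).
Proof.
have [tR tI] : trigpoly (fun t => complex.Re (gdsum c l m (x +i* t))) /\
    trigpoly (fun t => complex.Im (gdsum c l m (x +i* t))).
  rewrite /gdsum; elim: (index_iota 1 m) => [|n s [IHR IHI]].
    split; rewrite (_ : (fun t => _) = fun=> 0); try exact: trigpoly_cst.
      by apply/funext => t; rewrite big_nil.
    by apply/funext => t; rewrite big_nil.
  split.
    rewrite (_ : (fun t => _) = (fun t => complex.Re (c n * cexp (l n) (x +i* t)) +
      complex.Re (\sum_(i <- s) c i * cexp (l i) (x +i* t)))).
      by apply: TrigAdd IHR; exact: trigpoly_Re_term.
    by apply/funext => t; rewrite big_cons; case: (_ * _) => ? ?; case: (\sum_(_ <- _) _).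
  rewrite (_ : (fun t => _) = (fun t => complex.Im (c n * cexp (l n) (x +i* t)) +
    complex.Im (\sum_(i <- s) c i * cexp (l i) (x +i* t)))).
    by apply: TrigAdd IHI; exact: trigpoly_Im_term.
  by apply/funext => t; rewrite big_cons; case: (_ * _) => ? ?; case: (\sum_(_ <- _) _).
rewrite (_ : (fun t => _) = (fun t =>
    complex.Re (gdsum c l m (x +i* t)) * complex.Re (gdsum c l m (x +i* t)) +
    complex.Im (gdsum c l m (x +i* t)) * complex.Im (gdsum c l m (x +i* t)))).
  by apply/trigpoly_uap/TrigAdd; exact: trigpoly_mul.
by apply/funext => t; rewrite normc_sqr !expr2.
Qed.

Lemma uap_gdsum_powR (e q x : R) : 0 <= e -> 0 < q ->
  uap (fun t => (normc (gdsum c l m (x +i* t)) ^+ 2 + e) `^ q).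
Proof.
move=> e0 q0.
apply: (@uap_powR R (fun t => normc (gdsum c l m (x +i* t)) ^+ 2 + e)) => //.
  by apply: uapD; [exact: uap_gdsum|exact: uap_cst].
by move=> t; rewrite addr_ge0// sqr_ge0.
Qed.

Lemma normc_gdsum_sqr_le (x t : R) : 0 <= x ->
  0 <= normc (gdsum c l m (x +i* t)) ^+ 2 <= S ^+ 2.
Proof.
move=> x0; rewrite sqr_ge0/= lerXn2r ?nnegrE ?normc_ge0//.
  by apply: sumr_ge0 => n _; exact: normc_ge0.
exact: normc_gdsum_le.
Qed.

(** The two vertical neighbours have mean [bmean (F x)] each, which turns the factor 4 into 2. *)
Lemma bmean_second_difference (F : R -> R -> R) (x h d : R) :
  (forall y, uap (F y)) ->
  (forall t, 4 * F x t - d <= F (x + h) t + F x (t + h) + F (x - h) t + F x (t - h)) ->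
  2 * bmean (F x) - d <= bmean (F (x + h)) + bmean (F (x - h)).
Proof.
move=> uF H; have us c' : uap (fun t => F x (t + c')) by exact: uap_shift.
have u1 := uapD (uF (x + h)) (us h); have u2 := uapD u1 (uF (x - h)).
have u3 := uapD u2 (us (- h)).
have u4 := uapZ 4 (uF x).
have P := le_bmean (uapD u4 (uap_cst (- d))) u3 H.
rewrite (bmeanD u4 (uap_cst _)) bmeanZ// bmean_cst in P.
rewrite (bmeanD u2 (us _)) (bmeanD u1 (uF _)) (bmeanD (uF _) (us _)) in P.
rewrite !bmean_shift// in P; lra.
Qed.

Lemma sum_cardinal4 (f : R[i] -> R) (x t h : R) :
  \sum_j f ((x +i* t) + cardinal4 h j) =
  f ((x + h) +i* t) + f (x +i* (t + h)) + f ((x - h) +i* t) + f (x +i* (t - h)).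
Proof.
rewrite !big_ord_recl big_ord0 addr0 !cardinal4E/= !addrA.
by congr (f _ + f _ + f _ + f _); apply/eqP; rewrite eq_complex /= ?addr0 !eqxx.
Qed.

Lemma bmean_gdsum_regularized_le (e q : R) : 0 < e -> 0 < q -> forall x, 0 <= x ->
  bmean (fun t => (normc (gdsum c l m (x +i* t)) ^+ 2 + e) `^ q) <=
  bmean (fun t => (normc (gdsum c l m (0 +i* t)) ^+ 2 + e) `^ q).
Proof.
move=> e0 q0; pose F (x t : R) := (normc (gdsum c l m (x +i* t)) ^+ 2 + e) `^ q.
have uF x : uap (F x) by apply: uap_gdsum_powR => //; exact: ltW.
have [C [h0 [C0 h00 H]]] := gdsum_four_point c m l0 e0 q0.
apply: (@almost_convex_bounded_le R (fun x => bmean (F x)) C h0 ((S ^+ 2 + e) `^ q)) => //.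
  move=> x x0; have F0 t : 0 <= F x t by exact: powR_ge0.
  rewrite ger0_norm ?bmean_ge0// -(bmean_cst ((S ^+ 2 + e) `^ q)).
  apply: le_bmean => // [|t]; first exact: uap_cst.
  have /andP[n0 nS] := normc_gdsum_sqr_le t x0.
  apply: ge0_ler_powR; rewrite ?nnegrE ?addr_ge0 ?sqr_ge0 ?(ltW e0) ?(ltW q0)//.
  by rewrite lerD2r.
move=> h x hh hx.
have x0 : 0 <= x by case/andP: hh; lra.
apply: (bmean_second_difference uF) => t.
have := H h (x +i* t) hh x0.
by rewrite (sum_cardinal4 (fun s => (normc (gdsum c l m s) ^+ 2 + e) `^ q)).
Qed.

(** Adding [d] increases the mean at abscissa x and, as the squared moduli lie in [0, S^2], costs at
    most [e] at abscissa 0. *)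
Lemma bmean_gdsum_le (q x : R) : 0 < q -> 0 <= x ->
  bmean (fun t => (normc (gdsum c l m (x +i* t)) ^+ 2) `^ q) <=
  bmean (fun t => (normc (gdsum c l m (0 +i* t)) ^+ 2) `^ q).
Proof.
move=> q0 x0; have u y : uap (fun t => (normc (gdsum c l m (y +i* t)) ^+ 2) `^ q).
  by apply: (uap_powR q0); [exact: uap_gdsum|move=> t; exact: sqr_ge0].
apply/ler_addgt0Pr => e e0.
have [d d0 Hd] := @powR_addr_le R q (S ^+ 2) e q0 e0.
have ud y : uap (fun t => (normc (gdsum c l m (y +i* t)) ^+ 2 + d) `^ q).
  by apply: uap_gdsum_powR => //; exact: ltW.
apply: (@le_trans _ _ (bmean (fun t => (normc (gdsum c l m (x +i* t)) ^+ 2 + d) `^ q))).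
  apply: le_bmean => // t.
  apply: ge0_ler_powR; rewrite ?nnegrE ?addr_ge0 ?sqr_ge0 ?(ltW d0) ?(ltW q0)//.
  by rewrite lerDl ltW.
apply: le_trans (bmean_gdsum_regularized_le d0 q0 x0) _.
rewrite -[X in _ + X](bmean_cst e) -bmeanD//; last exact: uap_cst.
apply: le_bmean => // [|t]; first by apply: uapD => //; exact: uap_cst.
exact/Hd/normc_gdsum_sqr_le.
Qed.

End MonotoneMean.

(** * Triangle inequalities for means of p-th powers *)

Section MeanTriangle.
Variables (R : realType) (p : R).
Hypothesis p0 : 0 < p.

Lemma powR_convex (s u v : R) : 1 <= p -> 0 <= s <= 1 -> 0 <= u -> 0 <= v ->
  (s * u + (1 - s) * v) `^ p <= s * u `^ p + (1 - s) * v `^ p.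
Proof.
move=> p1 /andP[s0 s1] u0 v0.
have := convex_powR p1 (Itv01 s0 s1) (x := u) (y := v).
by rewrite !inE/= !in_itv/= !andbT; exact.
Qed.

Variables f g h : R -> R.
Hypotheses (f0 : forall t, 0 <= f t) (g0 : forall t, 0 <= g t) (h0 : forall t, 0 <= h t).
Hypotheses (uf : uap (fun t => f t `^ p)) (ug : uap (fun t => g t `^ p)).
Hypotheses (uh : uap (fun t => h t `^ p)) (hfg : forall t, h t <= f t + g t).

Let hp_le t : h t `^ p <= (f t + g t) `^ p.
Proof. by apply: ge0_ler_powR; rewrite ?nnegrE ?addr_ge0// ltW. Qed.

Lemma bmean_powR_subadd : p <= 1 ->
  bmean (fun t => h t `^ p) <= bmean (fun t => f t `^ p) + bmean (fun t => g t `^ p).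
Proof.
move=> p1; rewrite -(bmeanD uf ug); apply: le_bmean => // [|t]; first exact: uapD.
by rewrite (le_trans (hp_le t))// powR_subadd// p0.
Qed.

(** For positive [a] and [b] at least equal to the norms of [f] and [g], the sum f + g is (a + b)
    times the convex combination of f / a and g / b with weights a / (a + b) and b / (a + b);
    convexity of the p-th power is then averaged. *)
Lemma bmean_minkowski : 1 <= p ->
  bmean (fun t => h t `^ p) `^ p^-1 <=
  bmean (fun t => f t `^ p) `^ p^-1 + bmean (fun t => g t `^ p) `^ p^-1.
Proof.
move=> p1.
have Mf0 : 0 <= bmean (fun t => f t `^ p) by apply: bmean_ge0 => // t; exact: powR_ge0.
have Mg0 : 0 <= bmean (fun t => g t `^ p) by apply: bmean_ge0 => // t; exact: powR_ge0.
have Mh0 : 0 <= bmean (fun t => h t `^ p) by apply: bmean_ge0 => // t; exact: powR_ge0.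
have key a b : 0 < a -> 0 < b -> bmean (fun t => f t `^ p) <= a `^ p ->
    bmean (fun t => g t `^ p) <= b `^ p ->
    bmean (fun t => h t `^ p) <= (a + b) `^ p.
  move=> a0 b0 fa gb; have s0 : 0 < a + b by rewrite addr_gt0.
  have ap : 0 < a `^ p by rewrite powR_gt0.
  have bp : 0 < b `^ p by rewrite powR_gt0.
  have sp : 0 < (a + b) `^ p by rewrite powR_gt0.
  pose wa := (a + b) `^ p * (a / (a + b)) / a `^ p.
  pose wb := (a + b) `^ p * (b / (a + b)) / b `^ p.
  have wa0 : 0 <= wa by rewrite /wa !mulr_ge0 ?invr_ge0//; exact: ltW.
  have wb0 : 0 <= wb by rewrite /wb !mulr_ge0 ?invr_ge0//; exact: ltW.
  apply: (@le_trans _ _ (wa * bmean (fun t => f t `^ p) + wb * bmean (fun t => g t `^ p))).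
    rewrite -(bmeanZ wa uf) -(bmeanZ wb ug) -(bmeanD (uapZ wa uf) (uapZ wb ug)).
    apply: le_bmean => // [|t]; first by apply: uapD; exact: uapZ.
    apply: (le_trans (hp_le t)).
    have tw : 0 <= a / (a + b) <= 1.
      by rewrite divr_ge0 ?(ltW a0) ?(ltW s0)//= ler_pdivrMr// mul1r lerDl ltW.
    pose u := f t / a; pose v := g t / b.
    have u0 : 0 <= u by rewrite divr_ge0 ?(ltW a0).
    have v0 : 0 <= v by rewrite divr_ge0 ?(ltW b0).
    have fE : f t = a * u by rewrite /u mulrCA divff ?mulr1// gt_eqF.
    have gE : g t = b * v by rewrite /v mulrCA divff ?mulr1// gt_eqF.
    have -> : f t + g t = (a + b) * (a / (a + b) * u + (1 - a / (a + b)) * v).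
      by rewrite fE gE; field; rewrite gt_eqF.
    have w0 : 0 <= a / (a + b) * u + (1 - a / (a + b)) * v.
      by case/andP: tw => t0 t1; rewrite addr_ge0// mulr_ge0// subr_ge0.
    rewrite powRM ?(ltW s0)// fE gE (powRM _ (ltW a0) u0) (powRM _ (ltW b0) v0).
    have -> : wa * (a `^ p * u `^ p) + wb * (b `^ p * v `^ p) = (a + b) `^ p *
        (a / (a + b) * u `^ p + (1 - a / (a + b)) * v `^ p).
      by rewrite /wa /wb; field; rewrite !gt_eqF.
    by rewrite ler_wpM2l ?(ltW sp)// powR_convex.
  have -> : (a + b) `^ p = wa * a `^ p + wb * b `^ p.
    by rewrite /wa /wb; field; rewrite !gt_eqF.
  by rewrite lerD// ler_wpM2l.
move: key Mf0 Mg0 Mh0.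
move: (bmean (fun t => f t `^ p)) (bmean (fun t => g t `^ p)) (bmean (fun t => h t `^ p)).
move=> F G H key F0 G0 H0.
have ip0 : 0 <= p^-1 by rewrite invr_ge0 ltW.
have root (x : R) : 0 <= x -> (x `^ p^-1) `^ p = x.
  by move=> x0; rewrite -powRrM mulVf ?gt_eqF// powRr1.
apply/ler_addgt0Pr => e e0.
(* The margin [e / 2] makes [a] and [b] positive even when a norm vanishes. *)
pose a := F `^ p^-1 + e / 2; pose b := G `^ p^-1 + e / 2.
have e20 : 0 < e / 2 by rewrite divr_gt0.
have a0 : 0 < a by rewrite ltr_wpDl// powR_ge0.
have b0 : 0 < b by rewrite ltr_wpDl// powR_ge0.
have up (x : R) : 0 <= x -> x <= (x `^ p^-1 + e / 2) `^ p.
  move=> x0; rewrite -{1}(root x x0).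
  apply: ge0_ler_powR; rewrite ?nnegrE ?addr_ge0 ?powR_ge0 ?(ltW p0) ?(ltW e20)//.
  by rewrite lerDl ltW.
have K := key a b a0 b0 (up _ F0) (up _ G0).
rewrite (_ : F `^ p^-1 + G `^ p^-1 + e = a + b); last by rewrite /a /b; field.
have ab0 : 0 <= a + b by rewrite addr_ge0 ?(ltW a0) ?(ltW b0).
rewrite -[leRHS](_ : ((a + b) `^ p) `^ p^-1 = _); last first.
  by rewrite -powRrM mulfV ?gt_eqF// powRr1.
by apply: ge0_ler_powR; rewrite ?nnegrE ?powR_ge0.
Qed.

End MeanTriangle.

(** * Dirichlet polynomials *)

Section DirichletPolynomials.
Variables (R : realType) (p : R).
Hypothesis p0 : 0 < p.
Local Open Scope complex_scope.
Import ComplexField.Normc.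
Implicit Types (P Q : {poly R[i]}) (t x sigma : R).

Lemma normc_pow_half (z : R[i]) : normc z `^ p = (normc z ^+ 2) `^ (p / 2).
Proof.
by rewrite -powR_mulrn ?normc_ge0// -powRrM mulrCA divff ?mulr1.
Qed.

(** Any upper bound [m] of the size is allowed, so that polynomials of different sizes can be summed
    over a common range. *)
Lemma dpoly_evalE P (m : nat) (s : R[i]) : (size P <= m)%N ->
  dpoly_eval P s = gdsum (fun n => P`_n) (fun n => ln n%:R) m s.
Proof.
move=> Pm; rewrite /dpoly_eval /gdsum.
have [m0|m0] := leqP m 0.
  by move: m0 Pm; rewrite leqn0 => /eqP ->; rewrite leqn0 => /eqP ->.
have [s0|s0] := leqP (size P) 0.
  rewrite [LHS]big_geq ?(leq_trans s0)// big1// => n _.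
  by rewrite nth_default ?mul0r// (leq_trans s0).
rewrite [RHS](big_cat_nat (n := size P))//= -[LHS]addr0; congr (_ + _).
rewrite big_nat big1// => n /andP[sn _].
by rewrite nth_default ?mul0r.
Qed.

Lemma cexp_addl (a b : R) (s : R[i]) : cexp (a + b) s = cexp a s * cexp b s.
Proof.
case: s => x y; rewrite /cexp /=.
rewrite !mulrDr opprD expRD cosD sinD.
by apply/eqP; rewrite eq_complex /=; apply/andP; split; apply/eqP; ring.
Qed.

Definition dpoly_mean P : R := bmean (fun t => normc (dpoly_eval P (0 +i* t)) `^ p).

Lemma dpoly_meanE P :
  dpoly_mean P = bmean (fun t => normc (dpoly_eval P (0 +i* t)) `^ p).
Proof. by []. Qed.

Lemma dpoly_normE P : dpoly_norm p P = dpoly_mean P `^ p^-1.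
Proof. by rewrite /dpoly_mean bmeanE. Qed.

Lemma uap_dpoly P x : uap (fun t => normc (dpoly_eval P (x +i* t)) `^ p).
Proof.
rewrite (_ : (fun t => _) = (fun t => (normc (gdsum (fun n => P`_n)
    (fun n => ln n%:R) (size P) (x +i* t)) ^+ 2) `^ (p / 2))).
  by apply: uap_powR; [rewrite divr_gt0|exact: uap_gdsum|move=> t; exact: sqr_ge0].
by apply/funext => t; rewrite -normc_pow_half.
Qed.

Lemma dpoly_mean_ge0 P : 0 <= dpoly_mean P.
Proof. by apply: bmean_ge0 => [|t]; [exact: uap_dpoly|exact: powR_ge0]. Qed.

Definition dpoly_translate sigma P : {poly R[i]} :=
  \poly_(n < size P) ((n%:R `^ (- sigma))%:C * P`_n).

Lemma coef_dpoly_translate sigma P n :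
  (dpoly_translate sigma P)`_n = (n%:R `^ (- sigma))%:C * P`_n.
Proof.
by rewrite coef_poly; case: ltnP => // ?; rewrite nth_default ?mulr0.
Qed.

Lemma dpoly_translateB sigma P Q :
  dpoly_translate sigma (P - Q) = dpoly_translate sigma P - dpoly_translate sigma Q.
Proof.
by apply/polyP => n; rewrite coefB !coef_dpoly_translate coefB mulrBr.
Qed.

Lemma powR_natN (n : nat) x : (0 < n)%N -> n%:R `^ (- x) = expR (- (x * ln n%:R)).
Proof. by move=> n0; rewrite /powR pnatr_eq0 (gtn_eqF n0) mulNr. Qed.

Lemma npow_opp_shift (n : nat) x t : (0 < n)%N ->
  npow_opp n (x +i* t) = (n%:R `^ (- x))%:C * npow_opp n (0 +i* t).
Proof.
by move=> n0; rewrite /npow_opp/= powR_natN// mul0r oppr0 expR0 mul1r.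
Qed.

Lemma dpoly_eval_translate sigma P t :
  dpoly_eval (dpoly_translate sigma P) (0 +i* t) = dpoly_eval P (sigma +i* t).
Proof.
rewrite (dpoly_evalE _ (size_poly _ _)) (dpoly_evalE _ (leqnn _)).
rewrite /gdsum !big_nat; apply: eq_bigr => n /andP[n0 _].
rewrite coef_dpoly_translate [cexp _ (sigma +i* t)](npow_opp_shift sigma t n0).
by rewrite [RHS]mulrCA mulrA.
Qed.

Lemma dpoly_mean_translate_le sigma P (N : nat) : 0 <= sigma -> (1 <= N)%N ->
  (forall n, (1 <= n)%N -> (n < N)%N -> P`_n = 0) ->
  dpoly_mean (dpoly_translate sigma P) <= (N%:R `^ (- sigma)) `^ p * dpoly_mean P.
Proof.
move=> s0 N0 PN; have p20 : 0 < p / 2 by rewrite divr_gt0.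
have Np : 0 < N%:R :> R by rewrite ltr0n.
(* The maximum keeps the frequencies nonnegative at the indices below [N], whose coefficients
   vanish. *)
pose l n : R := ln (maxn N n)%:R - ln N%:R.
have l0 n : 0 <= l n.
  rewrite subr_ge0 ler_ln ?posrE ?ler_nat ?leq_maxl//.
  by rewrite ltr0n leq_max N0.
(* G(s) = N^s P(s) has nonnegative frequencies. *)
pose G := gdsum (fun n => P`_n) l (size P).
have PG x t : dpoly_eval P (x +i* t) = cexp (ln N%:R) (x +i* t) * G (x +i* t).
  rewrite (dpoly_evalE _ (leqnn _)) /G /gdsum mulr_sumr !big_nat.
  apply: eq_bigr => n /andP[n0 _].
  have [nN|Nn] := ltnP n N; first by rewrite PN// !mul0r mulr0.
  by rewrite [RHS]mulrCA -cexp_addl /l (maxn_idPr Nn) subrKC.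
have nPG x t : normc (dpoly_eval P (x +i* t)) `^ p =
    (N%:R `^ (- x)) `^ p * (normc (G (x +i* t)) ^+ 2) `^ (p / 2).
  by rewrite PG normcM normc_cexp/= -powR_natN// powRM ?powR_ge0 ?normc_ge0// normc_pow_half.
have uG x : uap (fun t => (normc (G (x +i* t)) ^+ 2) `^ (p / 2)).
  by apply: (uap_powR p20); [exact: uap_gdsum|move=> t; exact: sqr_ge0].
have -> : dpoly_mean P = bmean (fun t => (normc (G (0 +i* t)) ^+ 2) `^ (p / 2)).
  rewrite /dpoly_mean; congr bmean; apply/funext => t.
  by rewrite nPG oppr0 powRr0 powR1 mul1r.
have -> : dpoly_mean (dpoly_translate sigma P) = (N%:R `^ (- sigma)) `^ p *
    bmean (fun t => (normc (G (sigma +i* t)) ^+ 2) `^ (p / 2)).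
  rewrite /dpoly_mean -bmeanZ//; congr bmean; apply/funext => t.
  by rewrite dpoly_eval_translate nPG.
apply: ler_wpM2l; first exact: powR_ge0.
exact: (@bmean_gdsum_le R _ l _ l0 _ _ p20 s0).
Qed.

Lemma dpoly_evalN P s : dpoly_eval (- P) s = - dpoly_eval P s.
Proof.
rewrite (dpoly_evalE _ (leqnn _)) size_polyN (dpoly_evalE _ (leqnn _)) /gdsum -sumrN.
by apply: eq_bigr => n _; rewrite coefN mulNr.
Qed.

Lemma dpoly_meanN P : dpoly_mean (- P) = dpoly_mean P.
Proof.
rewrite /dpoly_mean; apply: (congr1 (@bmean R)); apply/funext => t.
by rewrite dpoly_evalN normcN.
Qed.

#[local] Opaque dpoly_mean.

Lemma dpoly_evalD P Q s : dpoly_eval (P + Q) s = dpoly_eval P s + dpoly_eval Q s.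
Proof.
rewrite (dpoly_evalE _ (size_polyD _ _)) (dpoly_evalE _ (leq_maxl (size P) (size Q))).
rewrite (dpoly_evalE _ (leq_maxr (size P) (size Q))) /gdsum -big_split/=.
by apply: eq_bigr => n _; rewrite coefD mulrDl.
Qed.

Lemma normc_dpoly_eval_le P (m : nat) t : (size P <= m)%N ->
  normc (dpoly_eval P (0 +i* t)) <= \sum_(1 <= n < m) normc P`_n.
Proof.
move=> Pm; rewrite (dpoly_evalE _ Pm) (le_trans (normc_sum_le _ _ _))//.
apply: ler_sum => n _; rewrite normcM -[leRHS]mulr1 ler_wpM2l ?normc_ge0//.
by rewrite normc_cexp/= mul0r oppr0 expR0.
Qed.

Let r := Num.min p 1.

Let r0 : 0 < r. Proof. by rewrite lt_min p0/=. Qed.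

(* Unlike the norm, it satisfies the triangle inequality also when p < 1. *)
Definition dpoly_dist P : R := dpoly_norm p P `^ r.

Lemma dpoly_dist_ge0 P : 0 <= dpoly_dist P.
Proof. exact: powR_ge0. Qed.

Lemma dpoly_norm_ge0 P : 0 <= dpoly_norm p P.
Proof. by rewrite dpoly_normE powR_ge0. Qed.

Lemma dpoly_norm_dist P : dpoly_norm p P = dpoly_dist P `^ r^-1.
Proof. by rewrite /dpoly_dist -powRrM mulfV ?gt_eqF// powRr1// dpoly_norm_ge0. Qed.

Lemma dpoly_mean_dist P : dpoly_dist P = dpoly_mean P `^ (r / p).
Proof. by rewrite /dpoly_dist dpoly_normE -powRrM mulrC. Qed.

Lemma dpoly_distN P : dpoly_dist (- P) = dpoly_dist P.
Proof. by rewrite !dpoly_mean_dist dpoly_meanN. Qed.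

Lemma dpoly_distC P Q : dpoly_dist (P - Q) = dpoly_dist (Q - P).
Proof. by rewrite -dpoly_distN opprB. Qed.

Lemma le_dpoly_mean_powR P (B : R) : 0 <= B ->
  (forall t, normc (dpoly_eval P (0 +i* t)) <= B) -> dpoly_mean P <= B `^ p.
Proof.
move=> B0 PB; rewrite dpoly_meanE -(bmean_cst (B `^ p)).
apply: le_bmean => [||t]; [exact: uap_dpoly|exact: uap_cst|].
by apply: ge0_ler_powR; rewrite ?nnegrE ?normc_ge0// ltW.
Qed.

Lemma le_dpoly_dist_powR P (B : R) : 0 <= B ->
  (forall t, normc (dpoly_eval P (0 +i* t)) <= B) -> dpoly_dist P <= B `^ r.
Proof.
move=> B0 PB; rewrite dpoly_mean_dist.
apply: (@le_trans _ _ ((B `^ p) `^ (r / p))); last first.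
  by rewrite -powRrM mulrCA divff ?mulr1// gt_eqF.
apply: ge0_ler_powR; rewrite ?nnegrE ?powR_ge0 ?dpoly_mean_ge0 ?divr_ge0 ?(ltW r0) ?(ltW p0)//.
exact: le_dpoly_mean_powR.
Qed.

Lemma powR_dpoly_dist_ge P (B : R) : 0 <= B ->
  (forall t, B <= normc (dpoly_eval P (0 +i* t))) -> B `^ r <= dpoly_dist P.
Proof.
move=> B0 PB; rewrite dpoly_mean_dist.
apply: (@le_trans _ _ ((B `^ p) `^ (r / p))).
  by rewrite -powRrM mulrCA divff ?mulr1// gt_eqF.
apply: ge0_ler_powR; rewrite ?nnegrE ?powR_ge0 ?dpoly_mean_ge0 ?divr_ge0 ?(ltW r0) ?(ltW p0)//.
rewrite dpoly_meanE -(bmean_cst (B `^ p)).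
apply: le_bmean => [||t]; [exact: uap_cst|exact: uap_dpoly|].
by apply: ge0_ler_powR; rewrite ?nnegrE ?normc_ge0// ltW.
Qed.

Lemma dpoly_dist_translate_le sigma P (N : nat) : 0 <= sigma -> (1 <= N)%N ->
  (forall n, (1 <= n)%N -> (n < N)%N -> P`_n = 0) ->
  dpoly_dist (dpoly_translate sigma P) <= (N%:R `^ (- sigma)) `^ r * dpoly_dist P.
Proof.
move=> s0 N0 PN; rewrite !dpoly_mean_dist.
have -> : (N%:R `^ (- sigma)) `^ r = ((N%:R `^ (- sigma)) `^ p) `^ (r / p) :> R.
  by rewrite -[RHS]powRrM mulrCA divff ?mulr1// gt_eqF.
rewrite -powRM ?powR_ge0 ?dpoly_mean_ge0//.
apply: ge0_ler_powR; rewrite ?nnegrE ?mulr_ge0 ?powR_ge0 ?dpoly_mean_ge0 ?divr_ge0 ?invr_ge0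
  ?(ltW r0) ?(ltW p0)//.
exact: dpoly_mean_translate_le.
Qed.

Lemma dpoly_distD P Q : dpoly_dist (P + Q) <= dpoly_dist P + dpoly_dist Q.
Proof.
have fD t : normc (dpoly_eval (P + Q) (0 +i* t)) <=
    normc (dpoly_eval P (0 +i* t)) + normc (dpoly_eval Q (0 +i* t)).
  by rewrite dpoly_evalD le_normcD.
have n0 S t : 0 <= normc (dpoly_eval S (0 +i* t)) by exact: normc_ge0.
(* The exponent [r / p] is 1 if p <= 1 and 1/p otherwise: subadditivity of the p-th powers in one
   case, Minkowski's inequality in the other. *)
have gen (a b c : R) : 0 <= a -> 0 <= b -> 0 <= c -> (p <= 1 -> c <= a + b) ->
    (1 <= p -> c `^ p^-1 <= a `^ p^-1 + b `^ p^-1) ->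
    c `^ (r / p) <= a `^ (r / p) + b `^ (r / p).
  move=> a0 b0 c0; rewrite /r; have [p1 H _|/ltW p1 _] := leP p 1; last by rewrite div1r; exact.
  by rewrite (divff (lt0r_neq0 p0)) !powRr1// H.
rewrite !dpoly_mean_dist; apply: gen; try exact: dpoly_mean_ge0.
  move=> p1; rewrite !dpoly_meanE.
  exact: (bmean_powR_subadd p0 (n0 P) (n0 Q) (n0 (P + Q)) (uap_dpoly P 0)
    (uap_dpoly Q 0) (uap_dpoly (P + Q) 0) fD p1).
move=> p1; rewrite !dpoly_meanE.
exact: (bmean_minkowski p0 (n0 P) (n0 Q) (n0 (P + Q)) (uap_dpoly P 0)
    (uap_dpoly Q 0) (uap_dpoly (P + Q) 0) fD p1).
Qed.

End DirichletPolynomials.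

#[local] Opaque dpoly_mean dpoly_dist.

(** * Convergence of powers and of complex sequences *)

Section CvgPowR.
Variable R : realType.
Import ComplexField.Normc.

(** The limit may be 0: the Hoelder estimate settles exponents at most 1, and an integer power does
    the rest. *)
Lemma cvg_powR (x : nat -> R) (l q : R) : 0 < q -> (forall k, 0 <= x k) ->
  x k @[k --> \oo] --> l -> x k `^ q @[k --> \oo] --> l `^ q.
Proof.
move=> q0 x0 xl.
have l0 : 0 <= l.
  rewrite -(cvg_lim (@norm_hausdorff _ _) xl); apply: limr_ge; last exact: nearW.
  exact: (cvgP l).
have [n [r01 rq]] := powR_root q0; set r := q / _ in r01 rq.
have r0 : 0 < r by lra.
have step : x k `^ r @[k --> \oo] --> l `^ r.
  apply/cvgrPdist_lt => e e0; have d0 : 0 < (e / 2) `^ r^-1 by rewrite powR_gt0 ?divr_gt0.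
  move/cvgrPdist_lt : xl => /(_ _ d0); apply: filterS => k kd.
  rewrite (le_lt_trans (powR_dist (x0 k) l0 r01))//.
  apply: (@le_lt_trans _ _ (((e / 2) `^ r^-1) `^ r)).
    by apply: ge0_ler_powR; rewrite ?nnegrE ?powR_ge0 ?(ltW r0)// ltW.
  by rewrite -powRrM mulVf ?gt_eqF// powRr1; lra.
have -> : (fun k => x k `^ q) = (fun k => (x k `^ r) ^+ n.+1).
  by apply/funext => k; rewrite rq.
rewrite rq//; elim: n.+1 => [|m IH]; first exact: cvg_cst.
rewrite (_ : (fun k => _) = (fun k => x k `^ r * (x k `^ r) ^+ m)); last first.
  by apply/funext => k; rewrite exprS.
by rewrite exprS; exact: cvgM.
Qed.

Lemma squeeze_cvg0D (x y z : nat -> R) : (forall k, 0 <= z k <= x k + y k) ->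
  x k @[k --> \oo] --> 0 -> y k @[k --> \oo] --> 0 -> z k @[k --> \oo] --> 0.
Proof.
move=> zxy xl yl.
have H : x k + y k @[k --> \oo] --> (0 + 0 : R) by exact: cvgD.
rewrite addr0 in H; apply: (@squeeze_cvgr _ _ _ _ (fun=> 0) (fun k => x k + y k)) => //.
  exact: nearW.
exact: cvg_cst.
Qed.

Lemma cvg_normcP (z : nat -> R[i]) (l : R[i]) :
  z k @[k --> \oo] --> (l : (R[i] : numFieldType)) <->
  ComplexField.Normc.normc (z k - l) @[k --> \oo] --> (0 : R).
Proof.
have nE (w : R[i]) : `|w| = real_complex R (ComplexField.Normc.normc w).
  by rewrite normc_def; case: w.
have [I1 I2] := @cvgrPdist_lt _ _ nat \oo _ (z : nat -> (R[i] : numFieldType)) l.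
split.
- move/I1 => H; apply/cvgr0Pnorm_lt => e e0.
  have := H (real_complex R e); rewrite ltcR => /(_ e0); apply: filterS => k.
  by rewrite nE ltcR ger0_norm ?normc_ge0// -normcN opprB.
- move/cvgr0Pnorm_lt => H.
  apply: I2 => e e0.
  have [er e1] : 0 < complex.Re e /\ e = real_complex R (complex.Re e).
    by move: e0; case: e => a b; rewrite ltcE/= => /andP[/eqP -> ].
  have := H _ er; apply: filterS => k.
  by rewrite nE e1 ltcR ger0_norm ?normc_ge0// -normcN opprB.
Qed.

End CvgPowR.

(** * Coefficient functionals and small translations *)

Section Coefficients.
Variables (R : realType) (p : R).
Hypothesis p0 : 0 < p.
Local Open Scope complex_scope.
Import ComplexField.Normc.
Implicit Types (P Q : {poly R[i]}) (sigma : R).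

Let r := Num.min p 1.
Let r0 : 0 < r. Proof. by rewrite lt_min p0/=. Qed.
Let r01 : 0 < r <= 1. Proof. by rewrite r0 ge_min lexx orbT. Qed.

Local Notation dist := (dpoly_dist p).

Lemma dpoly_dist0 : dist 0 = 0.
Proof.
apply/eqP; rewrite eq_le dpoly_dist_ge0 andbT.
rewrite -[leRHS](powR0 (lt0r_neq0 r0)); apply: le_dpoly_dist_powR => // t.
by rewrite /dpoly_eval size_poly0 big_geq// normc0.
Qed.

Lemma dpoly_dist_sum_le (I : Type) (s : seq I) (F : I -> {poly R[i]}) :
  dist (\sum_(i <- s) F i) <= \sum_(i <- s) dist (F i).
Proof.
elim: s => [|i s IH]; first by rewrite !big_nil dpoly_dist0.
rewrite !big_cons; apply: (le_trans (dpoly_distD p0 _ _)).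
by rewrite lerD2l.
Qed.

Let lerr_eq (x y : R) : x = y -> x <= y.
Proof. by move=> ->. Qed.

Lemma dpoly_distB_le P Q : dist (P - Q) <= dist P + dist Q.
Proof.
have := dpoly_distD p0 P (- Q).
move/le_trans; apply; apply: lerD; first exact: lexx.
by rewrite (dpoly_distN p Q) lexx.
Qed.

Lemma normc_dpoly_eval_monomial (a : R[i]) (n : nat) (t : R) : (1 <= n)%N ->
  normc (dpoly_eval (a *: 'X^n) (0 +i* t)) = normc a.
Proof.
move=> n1; have sz : (size (a *: 'X^n) <= n.+1)%N.
  by rewrite (leq_trans (size_scale_leq _ _))// size_polyXn.
rewrite (dpoly_evalE _ sz) /gdsum big_nat_recr//= big_nat big1 => [|k /andP[_ kn]].
  by rewrite add0r coefZ coefXn eqxx mulr1 normcM normc_cexp/= mul0r oppr0 expR0 mulr1.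
by rewrite coefZ coefXn (ltn_eqF kn) mulr0 mul0r.
Qed.

Lemma dpoly_dist_monomial (a : R[i]) (n : nat) : (1 <= n)%N ->
  dist (a *: 'X^n) = normc a `^ r.
Proof.
move=> n1; apply/eqP; rewrite eq_le; apply/andP; split.
  apply: le_dpoly_dist_powR => // [|t]; first exact: normc_ge0.
  by rewrite normc_dpoly_eval_monomial.
apply: powR_dpoly_dist_ge => // [|t]; first exact: normc_ge0.
by rewrite normc_dpoly_eval_monomial.
Qed.

Lemma dpoly_translate_monomial sigma (a : R[i]) (n : nat) :
  dpoly_translate sigma (a *: 'X^n) = ((n%:R `^ (- sigma))%:C * a) *: 'X^n.
Proof.
apply/polyP => k; rewrite coef_dpoly_translate !coefZ !coefXn.
by case: eqP => [->|]; rewrite ?mulr1 ?mulr0.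
Qed.

(* Translating by sigma -> +oo isolates the first coefficient of a Dirichlet
   polynomial, so contractivity of translations bounds that coefficient. *)
Lemma dpoly_dist_coef_ge P (N : nat) : (1 <= N)%N ->
  (forall n, (1 <= n)%N -> (n < N)%N -> P`_n = 0) -> normc P`_N `^ r <= dist P.
Proof.
move=> N1 PN; pose Q := P - P`_N *: 'X^N.
have N0 : 0 < N%:R :> R by rewrite ltr0n.
have QN n : (1 <= n)%N -> (n < N.+1)%N -> Q`_n = 0.
  move=> n1; rewrite ltnS leq_eqVlt coefB coefZ coefXn => /predU1P[->|nN].
    by rewrite eqxx mulr1 subrr.
  by rewrite (ltn_eqF nN) mulr0 subr0 PN.
pose kappa : R := ln N.+1%:R - ln N%:R.
have kappa0 : 0 < kappa by rewrite subr_gt0 ltr_ln ?posrE ?ltr_nat.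
apply/ler_addgt0Pr => e e0.
have [D [DE D0]] : exists D, dist Q = D /\ 0 <= D.
  by exists (dist Q); split => //; exact: dpoly_dist_ge0.
(* Chosen so that translation shrinks [Q], which starts at [N + 1], by an additional factor exp(- D
   / e) compared with index [N]; and D exp(- D / e) <= e. *)
pose sigma := D / e / (kappa * r).
have kr0 : 0 < kappa * r by rewrite mulr_gt0.
have s0 : 0 <= sigma by rewrite /sigma divr_ge0 ?(ltW kr0)// divr_ge0// ltW.
pose A : R := (N%:R `^ (- sigma)) `^ r.
have A0 : 0 < A by rewrite !powR_gt0.
have AS : (N.+1%:R `^ (- sigma)) `^ r = A * expR (- (D / e)) :> R.
  rewrite /A !powR_natN// -!expRM -expRD; congr expR.
  by rewrite /sigma /kappa; field; rewrite (gt_eqF r0) (gt_eqF kappa0) gt_eqF.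
have eD : expR (- (D / e)) * D <= e.
  rewrite expRN mulrC ler_pdivrMr ?expR_gt0// -ler_pdivrMl//.
  by rewrite mulrC (le_trans _ (expR_ge1Dx _))// lerDr.
have T : A * normc P`_N `^ r <= A * dist P + A * expR (- (D / e)) * D.
  have E1 : dist (dpoly_translate sigma (P`_N *: 'X^N)) = A * normc P`_N `^ r.
    rewrite dpoly_translate_monomial (dpoly_dist_monomial _ N1) normcM normc_real.
    by rewrite (ger0_norm (powR_ge0 _ _)) (powRM _ (powR_ge0 _ _) (normc_ge0 _)).
  have E2 : dpoly_translate sigma (P`_N *: 'X^N) =
      dpoly_translate sigma P - dpoly_translate sigma Q.
    by rewrite -dpoly_translateB; congr (dpoly_translate _ _); rewrite /Q subKr.
  have T1 := dpoly_dist_translate_le p0 s0 N1 PN.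
  have T2 := dpoly_dist_translate_le p0 s0 (isT : (1 <= N.+1)%N) QN.
  rewrite -/A in T1; rewrite AS DE in T2.
  have E3 := etrans (esym E1) (congr1 (dpoly_dist p) E2).
  exact: le_trans (lerr_eq E3) (le_trans (dpoly_distB_le _ _) (lerD T1 T2)).
move: T; move: (normc P`_N `^ r) (dist P) => x y T; rewrite -(ler_pM2l A0).
by rewrite (le_trans T)// mulrDr lerD2l -mulrA ler_wpM2l// ltW.
Qed.

(* The coefficient of index 0, which [dpoly_eval] ignores, is discarded. *)
Definition dpoly_low (N : nat) P : {poly R[i]} :=
  \poly_(n < N) (P`_n *+ (0 < n)%N).

Lemma coef_subr_dpoly_low N P n : (1 <= n)%N -> (n < N)%N -> (P - dpoly_low N P)`_n = 0.
Proof. by move=> n1 nN; rewrite coefB coef_poly nN n1 mulr1n subrr. Qed.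

Lemma dpoly_dist_low_le N P :
  dist (dpoly_low N P) <= \sum_(n < N) normc (P`_n *+ (0 < n)%N) `^ r.
Proof.
rewrite /dpoly_low poly_def; apply: (le_trans (dpoly_dist_sum_le _ _)).
apply: ler_sum => -[[|n] nN] _ /=; last by rewrite dpoly_dist_monomial.
by rewrite mulr0n scale0r dpoly_dist0 powR_ge0.
Qed.

(** By induction the earlier coefficients are controlled, hence so is the low part of [P]; once it
    is subtracted, the next coefficient is the first one and [dpoly_dist_coef_ge] applies. *)
Lemma dpoly_coef_le_dist N : exists2 C, 0 <= C & forall n P, (1 <= n)%N -> (n <= N)%N ->
  normc P`_n `^ r <= C * dist P.
Proof.
elim: N => [|N [C C0 HC]]; first by exists 0 => // n P /leq_trans h /h.
exists (C + (1 + N.+1%:R * C)) => [|n P n1]; first by rewrite !addr_ge0// mulr_ge0.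
have d0 := dpoly_dist_ge0 p P.
rewrite leq_eqVlt => /predU1P[->|nN]; last first.
  rewrite (le_trans (HC n P n1 nN))// ler_wpM2r// lerDl addr_ge0// mulr_ge0//.
have := @dpoly_dist_coef_ge (P - dpoly_low N.+1 P) N.+1 isT (coef_subr_dpoly_low P).
rewrite coefB coef_poly ltnn subr0 => /le_trans; apply.
apply: (le_trans (dpoly_distB_le _ _)).
have L : dist (dpoly_low N.+1 P) <= N.+1%:R * (C * dist P).
  apply: (le_trans (dpoly_dist_low_le _ _)).
  rewrite mulr_natl -[X in _ *+ X]card_ord -sumr_const.
  apply: ler_sum => -[[|k] kN] _ /=; last by rewrite mulr1n HC.
  by rewrite expr0n addr0 sqrtr0 (powR0 (lt0r_neq0 r0)) mulr_ge0.
move: L d0; move: (dist (dpoly_low _ _)) (dist P) => y x L x0.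
rewrite (_ : _ * x = C * x + x + N.+1%:R * (C * x)); last by ring.
by have := mulr_ge0 C0 x0; lra.
Qed.

(** On the imaginary axis P - T_tau P is at most tau S in modulus, because 1 - n^(-tau) <= tau ln n.
    Here tau depends on [P]. *)
Lemma dpoly_dist_translate_small P (e : R) : 0 < e ->
  exists2 tau, 0 < tau & dist (P - dpoly_translate tau P) <= e.
Proof.
move=> e0; pose S := \sum_(1 <= n < size P) normc P`_n * ln n%:R.
have ln0 (n : nat) : (1 <= n)%N -> 0 <= ln n%:R :> R.
  by move=> n1; rewrite ln_ge0// ler1n.
have S0 : 0 <= S.
  by rewrite /S big_nat; apply: sumr_ge0 => n /andP[n1 _]; rewrite mulr_ge0 ?normc_ge0 ?ln0.
pose tau := e `^ r^-1 / (S + 1).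
have er0 : 0 < e `^ r^-1 by rewrite powR_gt0.
have S10 : 0 < S + 1 by rewrite ltr_wpDl.
have tau0 : 0 < tau by rewrite divr_gt0.
exists tau => //.
have sz : (size (P - dpoly_translate tau P)%R <= size P)%N.
  by rewrite (leq_trans (size_polyD _ _))// size_polyN geq_max leqnn size_poly.
apply: (@le_trans _ _ ((e `^ r^-1) `^ r)); last first.
  by rewrite -powRrM mulVf ?gt_eqF// powRr1// ltW.
apply: le_dpoly_dist_powR => // [|t]; first exact: ltW.
rewrite (le_trans (normc_dpoly_eval_le _ sz))// (@le_trans _ _ (tau * S))//.
  rewrite /S mulr_sumr !big_nat; apply: ler_sum => n /andP[n1 _].
  rewrite coefB coef_dpoly_translate -[X in X - _]mul1r -mulrBl normcM mulrC mulrCA.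
  rewrite ler_wpM2l ?normc_ge0// powR_natN//.
  rewrite (_ : 1 - _ = (1 - expR (- (tau * ln n%:R)))%:C); last by rewrite rmorphB rmorph1.
  rewrite normc_real ger0_norm; last by rewrite subr_ge0 expR_le1 oppr_le0 mulr_ge0 ?ln0 ?ltW.
  by rewrite lerBlDr addrC -lerBlDr; exact: expR_ge1Dx.
by rewrite /tau mulrAC ler_pdivrMr// ler_wpM2l ?(ltW er0)// lerDl.
Qed.

End Coefficients.

(** * Passage to the completion *)

(* The completeness argument is carried out over an abstract group [V]: it only
   uses that the translations [T] are contractive and that [low N] splits off the
   first coefficients. *)
Section TranslationSemigroup.
Variables (R : realType) (V : zmodType) (d : V -> R) (T : R -> V -> V).
Variables (low : nat -> V -> V) (A : nat -> R -> R).
Hypotheses (d0 : forall x, 0 <= d x) (dB : forall x y, d (x - y) <= d x + d y).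
Hypotheses (dD : forall x y, d (x + y) <= d x + d y).
Hypothesis dC : forall x y, d (x - y) = d (y - x).
Hypothesis TB : forall s x y, T s (x - y) = T s x - T s y.
Hypothesis T_le : forall s x, 0 <= s -> d (T s x) <= d x.
Hypothesis T_low : forall s N x, 0 <= s -> (1 <= N)%N ->
  d (T s (x - low N x)) <= A N s * d (x - low N x).
Hypothesis A0 : forall N s, 0 <= A N s.
Hypothesis T_small : forall x e, 0 < e -> exists2 s, 0 < s & d (x - T s x) <= e.
Hypothesis A_small : forall s e, 0 < s -> 0 < e -> exists2 N, (1 <= N)%N & A N s <= e.

Definition d_cauchy (u : nat -> V) := forall e, 0 < e -> exists K : nat,
  forall j k, (K <= j)%N -> (K <= k)%N -> d (u j - u k) < e.

Lemma d_cauchyB u v : d_cauchy u -> d_cauchy v -> d_cauchy (fun k => u k - v k).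
Proof.
move=> cu cv e e0; have e20 : 0 < e / 2 by rewrite divr_gt0.
have [K1 H1] := cu _ e20; have [K2 H2] := cv _ e20.
exists (maxn K1 K2) => j k; rewrite !geq_max => /andP[j1 j2] /andP[k1 k2].
rewrite opprD addrACA -opprD (splitr e).
by rewrite (le_lt_trans (dB _ _))// ltrD// ?H1// H2.
Qed.

Lemma d_cauchyT s u : 0 <= s -> d_cauchy u -> d_cauchy (fun k => T s (u k)).
Proof.
move=> s0 cu e e0; have [K H] := cu _ e0; exists K => j k Kj Kk.
by rewrite -TB (le_lt_trans (T_le _ s0))// H.
Qed.

Lemma d_dist x y : `|d x - d y| <= d (x - y).
Proof.
rewrite ler_norml; apply/andP; split.
  by have := dD (y - x) x; rewrite subrK dC; lra.
by have := dD (x - y) y; rewrite subrK; lra.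
Qed.

Lemma d_cauchy_cvg u : d_cauchy u -> cvg (d (u k) @[k --> \oo]).
Proof.
move=> cu; apply/cauchy_cvgP/cauchyP => e e0; have [K H] := cu _ e0.
exists (d (u K)).
suff W : \forall k \near \oo, ball (d (u K)) e (d (u k)) by exact: W.
exists K => // k /= Kk; rewrite /ball/= (le_lt_trans (d_dist _ _))// H//.
Qed.

Lemma d_translate_low_le s N x : 0 <= s -> (1 <= N)%N ->
  d (T s x) <= A N s * (d x + d (low N x)) + d (low N x).
Proof.
move=> s0 N1; have -> : T s x = T s (x - low N x) + T s (low N x) by rewrite TB subrK.
rewrite (le_trans (dD _ _))// lerD ?T_le// (le_trans (T_low _ s0 N1))//.
by rewrite ler_wpM2l.
Qed.

(** The order of the choices matters: [K] from the Cauchy property, [s] for the single element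
    [w K], [N] for this [s], and only then [k]. The chain w k, w K, T s (w K), T s (w k) costs three
    times e / 5, and its last term is at most 2 e / 5. *)
Lemma d_cauchy_cvg0 w : d_cauchy w ->
  (forall N, d (low N (w k)) @[k --> \oo] --> (0 : R)) ->
  d (w k) @[k --> \oo] --> (0 : R).
Proof.
move=> cw lw; apply/cvgr0Pnorm_le => e e0.
have e50 : 0 < e / 5 by rewrite divr_gt0.
have [K HK] := cw _ e50.
have [s s0 xs] := T_small (w K) e50.
(* [B] bounds [d (w k)] and 1 bounds the low part, whence the denominator [B + 1] in the requirement
   on [A N s]. *)
pose B := d (w K) + e / 5.
have B0 : 0 < B + 1 by rewrite addr_gt0// ltr_wpDl.
have eB0 : 0 < e / 5 / (B + 1) by rewrite divr_gt0.
have [N N1 AN] := A_small s0 eB0.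
have m0 : 0 < Num.min 1 (e / 5) by rewrite lt_min ltr01/=.
move/cvgr0Pnorm_le : (lw N) => /(_ _ m0) [M _ HM].
exists (maxn K M) => // k /=; rewrite geq_max => /andP[Kk Mk].
have := HM k Mk; rewrite ger0_norm// le_min => /andP[l1 l2].
rewrite ger0_norm//.
have kK : d (w k - w K) <= e / 5 by rewrite ltW// HK.
have Kk' : d (w K - w k) <= e / 5 by rewrite dC.
have wB : d (w k) <= B.
  by rewrite -(subrK (w K) (w k)) (le_trans (dD _ _))// /B addrC lerD.
have Tk : d (T s (w k)) <= e / 5 + e / 5.
  rewrite (le_trans (d_translate_low_le _ (ltW s0) N1))// lerD//.
  rewrite (@le_trans _ _ (e / 5 / (B + 1) * (B + 1)))//.
    by rewrite ler_pM ?addr_ge0// lerD.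
  by rewrite divfK// gt_eqF.
have Tx : d (T s (w K)) <= e / 5 + (e / 5 + e / 5).
  have -> : T s (w K) = T s (w K - w k) + T s (w k) by rewrite TB subrK.
  by rewrite (le_trans (dD _ _))// lerD// (le_trans (T_le _ (ltW s0))).
have x3 : d (w K) <= e / 5 + (e / 5 + (e / 5 + e / 5)).
  by rewrite -(subrK (T s (w K)) (w K)) (le_trans (dD _ _))// lerD.
have : d (w k) <= e / 5 + (e / 5 + (e / 5 + (e / 5 + e / 5))).
  by rewrite -(subrK (w K) (w k)) (le_trans (dD _ _))// lerD.
by move: (d (w k)) => y; lra.
Qed.

(** [v] is linked to T s u through low parts only; [d_cauchy_cvg0], applied to the difference, shows
    that the two sequences are equivalent. *)
Lemma lim_d_translate_le u v N s : 0 <= s -> (1 <= N)%N -> d_cauchy u -> d_cauchy v ->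
  (forall M, d (low M (v k - T s (u k))) @[k --> \oo] --> (0 : R)) ->
  d (low N (u k)) @[k --> \oo] --> (0 : R) ->
  lim (d (v k) @[k --> \oo]) <= A N s * lim (d (u k) @[k --> \oo]).
Proof.
move=> s0 N1 cu cv lw lu.
have w0 := d_cauchy_cvg0 (d_cauchyB cv (d_cauchyT s0 cu)) lw.
have Du := d_cauchy_cvg cu; have Dv := d_cauchy_cvg cv.
pose F k := d (v k - T s (u k)) + (A N s * (d (u k) + d (low N (u k))) + d (low N (u k))).
have FC : F k @[k --> \oo] --> 0 + (A N s * (lim (d (u k) @[k --> \oo]) + 0) + 0).
  apply: cvgD => //; apply: cvgD => //; apply: cvgMr; exact: cvgD.
rewrite add0r !addr0 in FC.
rewrite -(cvg_lim (@norm_hausdorff _ _) FC); apply: ler_lim => //.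
  exact: (cvgP _ FC).
apply: nearW => k; rewrite -(subrK (T s (u k)) (v k)) (le_trans (dD _ _))//.
by rewrite /F lerD2l d_translate_low_le.
Qed.

End TranslationSemigroup.

(** * Norms and translations in the Hardy spaces *)

Section HardySpaceSequences.
Variables (R : realType) (p : R).
Hypothesis p0 : 0 < p.
Local Open Scope complex_scope.
Import ComplexField.Normc.

Let r := Num.min p 1.
Let r0 : 0 < r. Proof. by rewrite lt_min p0/=. Qed.
Let ri0 : 0 < r^-1. Proof. by rewrite invr_gt0. Qed.

Local Notation dist := (dpoly_dist p).


Lemma dpoly_cauchyP u : dpoly_cauchy p u <-> d_cauchy dist u.
Proof.
have H x (e : R) : 0 <= x -> 0 < e -> x < e -> forall q, 0 < q -> x `^ q < e `^ q.
  by move=> x0 e0 xe q q0; apply: gt0_ltr_powR; rewrite ?nnegrE// ltW.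
split=> cu e e0.
  have [K HK] := cu (e `^ r^-1) (powR_gt0 _ e0).
  exists K => j k Kj Kk; have := HK j k Kj Kk.
  move=> /(H _ _ (dpoly_norm_ge0 _ _) (powR_gt0 _ e0))/(_ _ r0).
  by rewrite -[X in _ < X -> _]powRrM mulVf ?gt_eqF// powRr1// ltW.
have [K HK] := cu (e `^ r) (powR_gt0 _ e0).
exists K => j k Kj Kk; have := HK j k Kj Kk.
move=> /(H _ _ (dpoly_dist_ge0 _ _) (powR_gt0 _ e0))/(_ _ ri0).
by rewrite -dpoly_norm_dist// -[X in _ < X -> _]powRrM mulfV ?gt_eqF// powRr1// ltW.
Qed.

Lemma dist_translate_le (s : R) (P : {poly R[i]}) : 0 <= s -> dist (dpoly_translate s P) <= dist P.
Proof.
move=> s0; have H : forall n, (1 <= n)%N -> (n < 1)%N -> P`_n = 0 by case.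
have := dpoly_dist_translate_le p0 s0 (isT : (1 <= 1)%N) H.
by rewrite !powR1 mul1r.
Qed.

(** The contraction factor N^(-s), raised to the power [r] because [dist] is the r-th power of the
    norm. *)
Let A (N : nat) (s : R) : R := (N%:R `^ (- s)) `^ r.

Let A_small s e : 0 < s -> 0 < e -> exists2 N, (1 <= N)%N & A N s <= e.
Proof.
move=> s0 e0; pose M := e `^ (- (s * r)^-1).
exists (Num.trunc M).+1 => //.
have M0 : 0 < M by rewrite powR_gt0.
have NM : M <= (Num.trunc M).+1%:R by rewrite ltW// truncnS_gt.
have sr : 0 < s * r by rewrite mulr_gt0.
rewrite /A -powRrM mulNr powRN invf_ple ?posrE ?powR_gt0//.
apply: (@le_trans _ _ (M `^ (s * r))); last first.
  by apply: ge0_ler_powR; rewrite ?nnegrE// ltW.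
by rewrite /M -powRrM mulNr mulVf ?gt_eqF// powR_inv1// ltW.
Qed.

Lemma dpoly_low_cvg0 (u : nat -> {poly R[i]}) N :
  (forall n, (1 <= n)%N -> (n < N)%N -> normc (u k)`_n @[k --> \oo] --> (0 : R)) ->
  dist (dpoly_low N (u k)) @[k --> \oo] --> (0 : R).
Proof.
move=> H; pose F k := \sum_(n < N) normc ((u k)`_n *+ (0 < n)%N) `^ r.
apply: (@squeeze_cvgr _ _ _ _ (fun=> 0) F).
- by apply: nearW => k; rewrite dpoly_dist_ge0 dpoly_dist_low_le.
- exact: cvg_cst.
- have -> : (0 : R) = \sum_(n < N) 0 by rewrite big1.
  rewrite /F; apply: cvg_big => [|n _].
    exact: add_continuous.
  rewrite -(powR0 (lt0r_neq0 r0)); apply: cvg_powR => // [k|]; first exact: normc_ge0.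
  case: n => -[|n] nN; last by rewrite /=; exact: H.
  under eq_fun do rewrite mulr0n normc0.
  exact: cvg_cst.
Qed.

Lemma dist_cvg_coef (u v : nat -> {poly R[i]}) n : (1 <= n)%N ->
  dist (u k - v k) @[k --> \oo] --> (0 : R) ->
  normc ((u k)`_n - (v k)`_n) @[k --> \oo] --> (0 : R).
Proof.
move=> n1 uv; have [C C0 HC] := dpoly_coef_le_dist p0 n.
have S : normc ((u k)`_n - (v k)`_n) `^ r @[k --> \oo] --> (0 : R).
  apply: (@squeeze_cvgr _ _ _ _ (fun=> 0) (fun k => C * dist (u k - v k))).
  - by apply: nearW => k; rewrite powR_ge0/= -coefB HC.
  - exact: cvg_cst.
  - by rewrite -(mulr0 C); exact: cvgMr.
have := cvg_powR ri0 (fun k => powR_ge0 _ _) S.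
rewrite powR0 ?lt0r_neq0//; apply: cvg_trans; apply: near_eq_cvg; apply: nearW => k.
by rewrite -powRrM mulfV ?gt_eqF// powRr1 ?normc_ge0.
Qed.

Lemma dpoly_equiv_dist (u v : nat -> {poly R[i]}) :
  dpoly_equiv p u v -> dist (u k - v k) @[k --> \oo] --> (0 : R).
Proof.
move=> uv; rewrite -(powR0 (lt0r_neq0 r0)).
exact: (cvg_powR r0 (fun k => dpoly_norm_ge0 p (u k - v k)) uv).
Qed.

Lemma dpoly_equiv_refl (u : nat -> {poly R[i]}) : dpoly_equiv p u u.
Proof.
rewrite /dpoly_equiv; apply: cvg_near_cst; apply: nearW => k.
by rewrite subrr (dpoly_norm_dist p0) dpoly_dist0// powR0 ?lt0r_neq0.
Qed.

Lemma Hp_reprP (f : Hp p) : dpoly_cauchy p (Hp_repr f) /\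
  Hp_class f = [set v | dpoly_cauchy p v /\ dpoly_equiv p (Hp_repr f) v].
Proof. by rewrite /Hp_repr; case: cid2. Qed.

Lemma Hp_norm_dist (f : Hp p) :
  Hp_norm f = lim (dist (Hp_repr f k) @[k --> \oo]) `^ r^-1.
Proof.
have [/dpoly_cauchyP cf _] := Hp_reprP f.
have C : cvg (dist (Hp_repr f k) @[k --> \oo]).
  exact: (d_cauchy_cvg (dpoly_distD p0) (dpoly_distC p) cf).
apply: cvg_lim => //.
have := cvg_powR ri0 (fun k => dpoly_dist_ge0 p (Hp_repr f k)) C.
by apply: cvg_trans; apply: near_eq_cvg; apply: nearW => k; rewrite dpoly_norm_dist.
Qed.

Lemma normc_dtranslate_cvg (s : R) (u : nat -> {poly R[i]}) (a : nat -> R[i]) n :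
  (u k)`_n @[k --> \oo] --> (a n : (R[i] : numFieldType)) ->
  normc ((dpoly_translate s (u k))`_n - dtranslate s a n) @[k --> \oo] --> (0 : R).
Proof.
move=> /cvg_normcP ua; rewrite -(mulr0 (n%:R `^ (- s))).
have H : n%:R `^ (- s) * normc ((u k)`_n - a n) @[k --> \oo] --> n%:R `^ (- s) * 0.
  exact: cvgMr.
apply: cvg_trans H; apply: near_eq_cvg; apply: nearW => k.
by rewrite coef_dpoly_translate -mulrBr normcM normc_real ger0_norm ?powR_ge0.
Qed.

Lemma is_dirichlet_series_translate (f Tf : Hp p) (a : nat -> R[i]) (s : R) :
  is_dirichlet_series f a ->
  dpoly_equiv p (fun k => dpoly_translate s (Hp_repr f k)) (Hp_repr Tf) ->
  is_dirichlet_series Tf (dtranslate s a).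
Proof.
move=> fa eqv n n1; apply/cvg_normcP.
have H1 := normc_dtranslate_cvg s (fa n n1).
have H2 := dist_cvg_coef n1 (dpoly_equiv_dist eqv).
apply: squeeze_cvg0D H1 H2 => k; rewrite normc_ge0/=.
set x := (Hp_repr Tf k)`_n; set y := (dpoly_translate s _)`_n; set z := dtranslate s a n.
rewrite (_ : x - z = (y - z) - (y - x)); last by ring.
by rewrite (le_trans (le_normcD _ _))// normcN.
Qed.

Lemma exists_translate (f : Hp p) (a : nat -> R[i]) (s : R) : 0 <= s ->
  is_dirichlet_series f a -> exists Tf : Hp p, is_dirichlet_series Tf (dtranslate s a).
Proof.
move=> s0 fa; have [cf _] := Hp_reprP f.
pose t k := dpoly_translate s (Hp_repr f k).
have ct : dpoly_cauchy p t.
  apply/dpoly_cauchyP; apply: (d_cauchyT (T := @dpoly_translate R)) s0 _.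
  - exact: dpoly_translateB.
  - by move=> *; exact: dist_translate_le.
  - exact/dpoly_cauchyP.
pose Tf : Hp p := MkHp (ex_intro2 _ (fun u => _ = [set v | dpoly_cauchy p v /\ dpoly_equiv p u v])
  t ct (erefl _)).
exists Tf; apply: is_dirichlet_series_translate fa _.
(* [Hp_repr Tf] is a chosen representative, not necessarily [t]; by reflexivity it lies in the class
   of [Tf], whose definition makes it equivalent to [t]. *)
have [cT eT] := Hp_reprP Tf.
have [_ eqv] : Hp_class Tf (Hp_repr Tf).
  by rewrite eT; split; [exact: cT|exact: dpoly_equiv_refl].
exact: eqv.
Qed.

(** [Tf] is any element with the translated series, not only the one built from the translates, so
    the representatives of [f] and [Tf] are compared through the limits of their coefficients. *)
Lemma Hp_norm_translate_le (f Tf : Hp p) (a : nat -> R[i]) (N : nat) (s : R) :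
  0 <= s -> (1 <= N)%N -> (forall n, (1 <= n)%N -> (n < N)%N -> a n = 0) ->
  is_dirichlet_series f a -> is_dirichlet_series Tf (dtranslate s a) ->
  Hp_norm Tf <= N%:R `^ (- s) * Hp_norm f.
Proof.
move=> s0 N1 aN fa Ta; rewrite !Hp_norm_dist.
have [/dpoly_cauchyP cf _] := Hp_reprP f; have [/dpoly_cauchyP cT _] := Hp_reprP Tf.
have D0 : 0 <= lim (dist (Hp_repr f k) @[k --> \oo]).
  apply: limr_ge; last by apply: nearW => k; exact: dpoly_dist_ge0.
  exact: (d_cauchy_cvg (dpoly_distD p0) (dpoly_distC p) cf).
have DT0 : 0 <= lim (dist (Hp_repr Tf k) @[k --> \oo]).
  apply: limr_ge; last by apply: nearW => k; exact: dpoly_dist_ge0.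
  exact: (d_cauchy_cvg (dpoly_distD p0) (dpoly_distC p) cT).
have L : lim (dist (Hp_repr Tf k) @[k --> \oo]) <=
    A N s * lim (dist (Hp_repr f k) @[k --> \oo]).
  have T_low s' M x : 0 <= s' -> (1 <= M)%N ->
      dist (dpoly_translate s' (x - dpoly_low M x)) <= A M s' * dist (x - dpoly_low M x).
    move=> s'0 M1; apply: (dpoly_dist_translate_le p0 s'0 M1) => n n1 nM.
    exact: coef_subr_dpoly_low.
  apply: (lim_d_translate_le (@dpoly_dist_ge0 R p) (dpoly_distB_le p0) (dpoly_distD p0)
    (@dpoly_distC R p) (@dpoly_translateB R) dist_translate_le T_low
    (fun _ _ => powR_ge0 _ _) (dpoly_dist_translate_small p0) A_small s0 N1 cf cT).
    move=> M; apply: dpoly_low_cvg0 => n n1 _.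
    have /cvg_normcP T1 := Ta n n1; have T2 := normc_dtranslate_cvg s (fa n n1).
    apply: squeeze_cvg0D T1 T2 => k; rewrite normc_ge0/= coefB.
    set x := (Hp_repr Tf k)`_n; set y := (dpoly_translate s _)`_n; set z := dtranslate s a n.
    rewrite (_ : x - y = (x - z) - (y - z)); last by ring.
    by rewrite (le_trans (le_normcD _ _))// normcN.
  apply: dpoly_low_cvg0 => n n1 nN.
  have /cvg_normcP := fa n n1; rewrite (aN n n1 nN).
  by apply: cvg_trans; apply: near_eq_cvg; apply: nearW => k; rewrite subr0.
(* Extracting r-th roots leads back from [dist] to the norm. *)
have gen (k x y : R) : 0 <= k -> 0 <= x -> 0 <= y -> y <= k `^ r * x ->
    y `^ r^-1 <= k * x `^ r^-1.
  move=> k0 x0 y0 yx.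
  rewrite -{1}(powRr1 k0) -(mulfV (lt0r_neq0 r0)) powRrM -powRM ?powR_ge0//.
  by apply: ge0_ler_powR; rewrite ?nnegrE ?(ltW ri0)// mulr_ge0// powR_ge0.
exact: (gen _ _ _ (powR_ge0 _ _) D0 DT0 L).
Qed.

End HardySpaceSequences.

Theorem theoremC (R : realType) (p : R) (hp : 0 < p)
    (f : Hp p) (a : nat -> R[i]) (hf : is_dirichlet_series f a)
    (N : nat) (hN : (1 <= N)%N)
    (ha : forall n : nat, (1 <= n)%N -> (n < N)%N -> a n = 0)
    (sigma : R) (hsigma : 0 <= sigma) :
  (exists Tf : Hp p, is_dirichlet_series Tf (dtranslate sigma a)) /\
  (forall Tf : Hp p, is_dirichlet_series Tf (dtranslate sigma a) ->
     Hp_norm Tf <= N%:R `^ (- sigma) * Hp_norm f).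
Proof.
split; first exact: exists_translate hsigma hf.
by move=> Tf hTf; exact: Hp_norm_translate_le ha hf hTf.
Qed.
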